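(* Let $\mathcal B$ be a Krull–Schmidt exact category with enough projectives and enough injectives, and let $(\mathcal U,\mathcal V)$ be a cotorsion pair on $\mathcal B$ with heart $\underline{\mathcal H}=\mathcal H/\mathcal W$. Let $\mathcal K=\operatorname{add}(\mathcal U*\mathcal V)$. (a) There exists a half exact functor $H:\mathcal B\to\underline{\mathcal H}$ (called the half exact functor associated with $(\mathcal U,\mathcal V)$) such that $H|_{\mathcal H}=\pi|_{\mathcal H}$ and such that, for any object $X\in\mathcal B$, $H(X)=0$ if and only if $X\in\mathcal K$. (b) If a half exact functor $G:\mathcal B\to\underline{\mathcal H}$ satisfies $G|_{\mathcal H}=\pi|_{\mathcal H}$ and $G(X)=0$ for every object $X\in\mathcal K$, then $G\simeq H$ (natural isomorphism of functors).
   Context: Exact category is meant in the sense of Quillen; short exact sequences (conflations) are written $A\rightarrowtail B\twoheadrightarrow C$. A cotorsion pair on $\mathcal B$ is a pair $(\mathcal U,\mathcal V)$ of full additive subcategories closed under direct summands such that $\operatorname{Ext}^1_{\mathcal B}(\mathcal U,\mathcal V)=0$ and every $B\in\mathcal B$ admits short exact sequences $V_B\rightarrowtail U_B\twoheadrightarrow B$ and $B\rightarrowtail V^B\twoheadrightarrow U^B$ with $U_B,U^B\in\mathcal U$, $V_B,V^B\in\mathcal V$. Put $\mathcal W=\mathcal U\cap\mathcal V$. $\mathcal B^+$ is the full subcategory of objects $B$ admitting a short exact sequence $V_B\rightarrowtail W_B\twoheadrightarrow B$ with $V_B\in\mathcal V$, $W_B\in\mathcal W$; $\mathcal B^-$ is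 the full subcategory of objects $B$ admitting a short exact sequence $B\rightarrowtail W^B\twoheadrightarrow U^B$ with $W^B\in\mathcal W$, $U^B\in\mathcal U$; $\mathcal H=\mathcal B^+\cap\mathcal B^-$. $\mathcal B/\mathcal W$ is the ideal quotient (same objects; morphisms modulo those factoring through an object of $\mathcal W$), $\pi:\mathcal B\to\mathcal B/\mathcal W$ is the canonical functor, and the heart $\underline{\mathcal H}=\mathcal H/\mathcal W$ is the full subcategory of $\mathcal B/\mathcal W$ on the objects of $\mathcal H$; it is known to be an abelian category. $\operatorname{add}(\mathcal U*\mathcal V)$ is the full subcategory of objects $X$ for which there exist an object $Y$ and a short exact sequence $U\rightarrowtail X\oplus Y\twoheadrightarrow V$ with $U\in\mathcal U$, $V\in\mathcal V$. A covariant functor $F$ from $\mathcal B$ to an abelian category is half exact if for every short exact sequence $A\stackrel{f}{\rightarrowtail}B\stackrel{g}{\twoheadrightarrow}C$ in $\mathcal B$ the sequence $F(A)\xrightarrow{F(f)}F(B)\xrightarrow{F(g)}F(C)$ is exact. *)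

(* Defs.v *)
From HB Require Import structures.
From mathcomp Require Import all_boot all_algebra.
From mathcomp Require Import boolp.

Set Implicit Arguments.
Unset Strict Implicit.
Unset Printing Implicit Defensive.

Import GRing.Theory.
Local Open Scope ring_scope.
Local Open Scope quotient_scope.

Declare Scope cat_scope.
Delimit Scope cat_scope with cat.
Reserved Notation "g ∘ f" (at level 40, left associativity).

Record preaddCat := PreaddCat {
  Ob :> Type;
  Hom : Ob -> Ob -> zmodType;
  idm : forall A, Hom A A;
  compm : forall A B C, Hom B C -> Hom A B -> Hom A C;
  compmA : forall A B C D (h : Hom C D) (g : Hom B C) (f : Hom A B),
    compm h (compm g f) = compm (compm h g) f;
  comp1m : forall A B (f : Hom A B), compm (idm B) f = f;
  compm1 : forall A B (f : Hom A B), compm f (idm A) = f;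
  compmDl : forall A B C (g g' : Hom B C) (f : Hom A B),
    compm (g + g') f = compm g f + compm g' f;
  compmDr : forall A B C (g : Hom B C) (f f' : Hom A B),
    compm g (f + f') = compm g f + compm g f' }.

Arguments idm {p} A.

Notation "g ∘ f" := (compm g f) : cat_scope.
Local Open Scope cat_scope.

Section PreadditiveNotions.
Variable C : preaddCat.
Implicit Types A B D : C.

Fact comp0m A B D (f : Hom A B) : 0 ∘ f = 0 :> Hom A D.
Proof. by apply: (addrI (0 ∘ f)); rewrite -compmDl !addr0. Qed.

Fact compm0 A B D (g : Hom B D) : g ∘ 0 = 0 :> Hom A D.
Proof. by apply: (addrI (g ∘ 0)); rewrite -compmDr !addr0. Qed.

Fact compNm A B D (g : Hom B D) (f : Hom A B) : (- g) ∘ f = - (g ∘ f).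
Proof. by apply: (addrI (g ∘ f)); rewrite -compmDl !subrr comp0m. Qed.

Fact compmN A B D (g : Hom B D) (f : Hom A B) : g ∘ (- f) = - (g ∘ f).
Proof. by apply: (addrI (g ∘ f)); rewrite -compmDr !subrr compm0. Qed.

Definition is_iso A B (f : Hom A B) :=
  exists g : Hom B A, g ∘ f = idm A /\ f ∘ g = idm B.

Definition is_zero A :=
  forall B, (forall f : Hom A B, f = 0) /\ (forall f : Hom B A, f = 0).

Definition is_biprod A B S (i1 : Hom A S) (i2 : Hom B S)
    (p1 : Hom S A) (p2 : Hom S B) :=
  [/\ p1 ∘ i1 = idm A, p2 ∘ i2 = idm B, p2 ∘ i1 = 0, p1 ∘ i2 = 0
    & i1 ∘ p1 + i2 ∘ p2 = idm S].

Definition is_dirsum n (X : 'I_n -> C) S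
    (i : forall k, Hom (X k) S) (p : forall k, Hom S (X k)) :=
  [/\ forall k, p k ∘ i k = idm (X k),
      forall k l, k <> l -> p l ∘ i k = 0
    & \sum_(k < n) i k ∘ p k = idm S].

Definition is_kernel A B D (g : Hom B D) (k : Hom A B) :=
  g ∘ k = 0 /\
  forall T (t : Hom T B), g ∘ t = 0 -> exists! u : Hom T A, k ∘ u = t.

Definition is_cokernel A B D (f : Hom A B) (c : Hom B D) :=
  c ∘ f = 0 /\
  forall T (t : Hom B T), t ∘ f = 0 -> exists! u : Hom D T, u ∘ c = t.

Definition is_image A B I (f : Hom A B) (m : Hom I B) :=
  exists Q (c : Hom B Q), is_cokernel f c /\ is_kernel c m.

(* Im f = Ker g as subobjects of B; the image is the kernel of the cokernel. *)
Definition exact_at A B D (f : Hom A B) (g : Hom B D) :=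
  exists I (m : Hom I B), is_image f m /\ is_kernel g m.

Definition is_pushout A B A' B' (i : Hom A B) (a : Hom A A')
    (i' : Hom A' B') (b : Hom B B') :=
  b ∘ i = i' ∘ a /\
  forall T (s : Hom B T) (t : Hom A' T), s ∘ i = t ∘ a ->
    exists! u : Hom B' T, u ∘ b = s /\ u ∘ i' = t.

Definition is_pullback B D B' D' (p : Hom B D) (d : Hom D' D)
    (p' : Hom B' D') (b : Hom B' B) :=
  p ∘ b = d ∘ p' /\
  forall T (s : Hom T B) (t : Hom T D'), p ∘ s = d ∘ t ->
    exists! u : Hom T B', b ∘ u = s /\ p' ∘ u = t.

(* The ring End(A) is nonzero and its non-units are closed under addition. *)
Definition local_End A :=
  idm A <> 0 /\
  forall f g : Hom A A, ~ is_iso f -> ~ is_iso g -> ~ is_iso (f + g).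

Definition krull_schmidt :=
  forall S, exists n (X : 'I_n -> C) i p,
    @is_dirsum n X S i p /\ forall k, local_End (X k).

Record addSub := AddSub {
  in_sub :> C -> Prop;
  sub_zero : forall Z, is_zero Z -> in_sub Z;
  sub_biprod : forall A B S (i1 : Hom A S) (i2 : Hom B S) p1 p2,
    is_biprod i1 i2 p1 p2 -> in_sub A -> in_sub B -> in_sub S;
  sub_summand : forall A B S (i1 : Hom A S) (i2 : Hom B S) p1 p2,
    is_biprod i1 i2 p1 p2 -> in_sub S -> in_sub A }.

Section Intersection.
Variables U V : addSub.
Let inUV A := U A /\ V A.

Fact addSubI_zero Z : is_zero Z -> inUV Z.
Proof. by move=> Z0; split; apply: sub_zero. Qed.

Fact addSubI_biprod A B S (i1 : Hom A S) (i2 : Hom B S) p1 p2 :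
  is_biprod i1 i2 p1 p2 -> inUV A -> inUV B -> inUV S.
Proof.
by move=> biS [UA VA] [UB VB]; split; apply: (sub_biprod biS).
Qed.

Fact addSubI_summand A B S (i1 : Hom A S) (i2 : Hom B S) p1 p2 :
  is_biprod i1 i2 p1 p2 -> inUV S -> inUV A.
Proof. by move=> biS [US VS]; split; apply: (sub_summand biS). Qed.

Definition addSubI : addSub :=
  AddSub addSubI_zero addSubI_biprod addSubI_summand.

End Intersection.

End PreadditiveNotions.

Record addCat := AddCat {
  acat :> preaddCat;
  has_zero : exists Z : acat, is_zero Z;
  has_biprod : forall A B : acat,
    exists S (i1 : Hom A S) (i2 : Hom B S) p1 p2, is_biprod i1 i2 p1 p2 }.

(* Exact categories in the sense of Quillen, in Bühler's form of the axioms (Exact categories,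
   Expo. Math. 28, 2010, Definition 2.1). *)
Record exactCat := ExactCat {
  ecat :> addCat;
  conflation : forall A B D : ecat, Hom A B -> Hom B D -> Prop;
  inflation := fun (A B : ecat) (i : Hom A B) =>
    exists D (p : Hom B D), conflation i p;
  deflation := fun (B D : ecat) (p : Hom B D) =>
    exists A (i : Hom A B), conflation i p;
  conflation_kercoker : forall A B D (i : Hom A B) (p : Hom B D),
    conflation i p -> is_kernel p i /\ is_cokernel i p;
  conflation_iso : forall A B D A' B' D'
      (i : Hom A B) (p : Hom B D) (i' : Hom A' B') (p' : Hom B' D')
      (a : Hom A A') (b : Hom B B') (d : Hom D D'),
    is_iso a -> is_iso b -> is_iso d -> b ∘ i = i' ∘ a -> d ∘ p = p' ∘ b ->
    conflation i p -> conflation i' p';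
  inflation_id : forall A, inflation (idm A);
  deflation_id : forall A, deflation (idm A);
  inflation_comp : forall A B D (i : Hom A B) (j : Hom B D),
    inflation i -> inflation j -> inflation (j ∘ i);
  deflation_comp : forall A B D (p : Hom A B) (q : Hom B D),
    deflation p -> deflation q -> deflation (q ∘ p);
  inflation_pushout : forall A B A' (i : Hom A B) (a : Hom A A'),
    inflation i -> exists B' (i' : Hom A' B') (b : Hom B B'),
      is_pushout i a i' b /\ inflation i';
  deflation_pullback : forall B D D' (p : Hom B D) (d : Hom D' D),
    deflation p -> exists B' (p' : Hom B' D') (b : Hom B' B),
      is_pullback p d p' b /\ deflation p' }.

Section ExactNotions.
Variable B : exactCat.
Implicit Types X Y P I : B.

Definition projective P :=
  forall X Y (p : Hom X Y) (f : Hom P Y), deflation p ->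
    exists h : Hom P X, p ∘ h = f.

Definition injective_ob I :=
  forall X Y (i : Hom X Y) (f : Hom X I), inflation i ->
    exists h : Hom Y I, h ∘ i = f.

Definition enough_projectives :=
  forall X, exists P (p : Hom P X), projective P /\ deflation p.

Definition enough_injectives :=
  forall X, exists I (i : Hom X I), injective_ob I /\ inflation i.

Definition ext_equiv X E E' Y (i : Hom Y E) (p : Hom E X)
    (i' : Hom Y E') (p' : Hom E' X) :=
  exists e : Hom E E', [/\ is_iso e, e ∘ i = i' & p' ∘ e = p].

(* Ext^1(X, Y) is the group of equivalence classes of conflations
   Y >-> E ->> X; it vanishes iff there is only one class. *)
Definition Ext1_zero X Y :=
  forall E E' (i : Hom Y E) (p : Hom E X) (i' : Hom Y E') (p' : Hom E' X),
    conflation i p -> conflation i' p' -> ext_equiv i p i' p'.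

Variables U V : addSub B.

Definition cotorsion_pair :=
  [/\ forall X Y, U X -> V Y -> Ext1_zero X Y,
      forall X, exists V_X U_X (i : Hom V_X U_X) (p : Hom U_X X),
        [/\ V V_X, U U_X & conflation i p]
    & forall X, exists V_X U_X (i : Hom X V_X) (p : Hom V_X U_X),
        [/\ V V_X, U U_X & conflation i p]].

Definition subW : addSub B := addSubI U V.

Definition in_Bplus X :=
  exists V_X W_X (i : Hom V_X W_X) (p : Hom W_X X),
    [/\ V V_X, subW W_X & conflation i p].

Definition in_Bminus X :=
  exists W_X U_X (i : Hom X W_X) (p : Hom W_X U_X),
    [/\ subW W_X, U U_X & conflation i p].

Definition in_H X := in_Bplus X /\ in_Bminus X.

Definition in_addUV X :=
  exists Y S (i1 : Hom X S) (i2 : Hom Y S) (p1 : Hom S X) (p2 : Hom S Y),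
    is_biprod i1 i2 p1 p2 /\
    exists U_X V_X (i : Hom U_X S) (p : Hom S V_X),
      [/\ U U_X, V V_X & conflation i p].

End ExactNotions.

(* Functors are not required to be additive: a half exact functor
   automatically is. *)
Record functor (C D : preaddCat) := Functor {
  fob :> C -> D;
  fmap : forall A B : C, Hom A B -> Hom (fob A) (fob B);
  fmap1 : forall A : C, fmap (idm A) = idm (fob A);
  fmapM : forall (A B E : C) (g : Hom B E) (f : Hom A B),
    fmap (g ∘ f) = fmap g ∘ fmap f }.

Arguments fmap {C D} f {A B} _ : rename.

Definition nat_iso (C D : preaddCat) (F G : functor C D) :=
  exists eta : forall X, Hom (F X) (G X),
    (forall X Y (f : Hom X Y), eta Y ∘ fmap F f = fmap G f ∘ eta X) /\
    (forall X, is_iso (eta X)).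

Definition half_exact (B : exactCat) (D : preaddCat) (F : functor B D) :=
  forall (X Y Z : B) (f : Hom X Y) (g : Hom Y Z), conflation f g ->
    exact_at (fmap F f) (fmap F g).

Section FullSubcategory.
Variables (C : preaddCat) (P : C -> Prop).

Definition fullSub : preaddCat := @PreaddCat {X : C | P X}
  (fun X Y => Hom (sval X) (sval Y)) (fun X => idm (sval X))
  (fun X Y Z g f => g ∘ f)
  (fun _ _ _ _ h g f => compmA h g f) (fun _ _ f => comp1m f)
  (fun _ _ f => compm1 f) (fun _ _ _ g g' f => compmDl g g' f)
  (fun _ _ _ g f f' => compmDr g f f').

Definition frestr (D : preaddCat) (F : functor C D) : functor fullSub D :=
  @Functor fullSub D (fun X => F (sval X))
    (fun X Y (f : Hom (sval X) (sval Y)) => fmap F f)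
    (fun X => fmap1 F (sval X)) (fun _ _ _ g f => fmapM F g f).

Definition fcorestr (D : preaddCat) (F : functor D C)
    (PF : forall X, P (F X)) : functor D fullSub :=
  @Functor D fullSub (fun X => exist P (F X) (PF X))
    (fun _ _ f => fmap F f) (fun X => fmap1 F X)
    (fun _ _ _ g f => fmapM F g f).

End FullSubcategory.

Section IdealQuotient.
Variables (C : addCat) (W : addSub C).
Implicit Types A B D : C.

Definition factors_through A B (f : Hom A B) :=
  exists X (h : Hom A X) (g : Hom X B), W X /\ f = g ∘ h.

Definition factor_ideal A B : {pred Hom A B} :=
  fun f => `[< factors_through f >].

Fact factor_ideal_closed A B : zmod_closed (@factor_ideal A B).
Proof.
split=> [|f f' /asboolP[X [h [g [WX ->]]]] /asboolP[X' [h' [g' [WX' ->]]]]].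
  have [Z Z0] := has_zero C.
  apply/asboolP; exists Z, 0, 0; split; first exact: sub_zero.
  by rewrite comp0m.
have [S [i1 [i2 [p1 [p2 biS]]]]] := has_biprod X X'.
apply/asboolP; exists S, (i1 ∘ h + i2 ∘ h'), (g ∘ p1 - g' ∘ p2).
split; first exact: (sub_biprod biS).
case: biS => p1i1 p2i2 p2i1 p1i2 _.
have mid (E F G K : C) (u : Hom F G) (v : Hom E F) (w : Hom K E) (t : Hom G B) :
    t ∘ u ∘ (v ∘ w) = t ∘ (u ∘ v) ∘ w by rewrite !compmA.
rewrite compmDr !compmDl !compNm !mid p1i1 p2i2 p2i1 p1i2.
by rewrite !compm0 !comp0m !compm1 oppr0 addr0 add0r.
Qed.

HB.instance Definition _ A B :=
  GRing.isZmodClosed.Build (Hom A B) (@factor_ideal A B)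
    (factor_ideal_closed A B).

Definition qHom A B : zmodType := Quotient.quot (@factor_ideal A B).

Definition qclass A B (f : Hom A B) : qHom A B :=
  \pi_(Quotient.quot (@factor_ideal A B)) f.

Definition qcomp A B D (g : qHom B D) (f : qHom A B) : qHom A D :=
  qclass (repr g ∘ repr f).

Fact qclassP A B (f f' : Hom A B) :
  qclass f = qclass f' <-> factors_through (f - f').
Proof.
split=> [/eqP|ff'].
  by rewrite /qclass -Quotient.idealrBE => /asboolP.
by apply/eqP; rewrite /qclass -Quotient.idealrBE; apply/asboolP.
Qed.

Fact qclass_repr A B (u : qHom A B) : qclass (repr u) = u.
Proof. exact: reprK. Qed.

Fact qclassD A B (f f' : Hom A B) : qclass (f + f') = qclass f + qclass f'.
Proof. exact: Quotient.pi_add. Qed.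

Fact qclassM A B D (g : Hom B D) (f : Hom A B) :
  qclass (g ∘ f) = qcomp (qclass g) (qclass f).
Proof.
set g' := repr (qclass g); set f' := repr (qclass f).
have /qclassP[X [h [k [WX gE]]]] : qclass g = qclass g' by rewrite qclass_repr.
have /qclassP[Y [l [m [WY fE]]]] : qclass f = qclass f' by rewrite qclass_repr.
rewrite /qcomp; transitivity (qclass (g' ∘ f)); apply/qclassP.
  by exists X, (h ∘ f), k; rewrite -compNm -compmDl gE compmA.
by exists Y, l, (g' ∘ m); rewrite -compmN -compmDr fE compmA.
Qed.

Fact qcompA A B D E (h : qHom D E) (g : qHom B D) (f : qHom A B) :
  qcomp h (qcomp g f) = qcomp (qcomp h g) f.
Proof.
rewrite -[h]qclass_repr -[g]qclass_repr -[f]qclass_repr.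
by rewrite -!qclassM compmA.
Qed.

Fact qcomp1m A B (f : qHom A B) : qcomp (qclass (idm B)) f = f.
Proof. by rewrite -[f]qclass_repr -qclassM comp1m. Qed.

Fact qcompm1 A B (f : qHom A B) : qcomp f (qclass (idm A)) = f.
Proof. by rewrite -[f]qclass_repr -qclassM compm1. Qed.

Fact qcompDl A B D (g g' : qHom B D) (f : qHom A B) :
  qcomp (g + g') f = qcomp g f + qcomp g' f.
Proof.
rewrite -[g]qclass_repr -[g']qclass_repr -[f]qclass_repr.
by rewrite -qclassD -!qclassM compmDl qclassD.
Qed.

Fact qcompDr A B D (g : qHom B D) (f f' : qHom A B) :
  qcomp g (f + f') = qcomp g f + qcomp g f'.
Proof.
rewrite -[g]qclass_repr -[f]qclass_repr -[f']qclass_repr.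
by rewrite -qclassD -!qclassM compmDr qclassD.
Qed.

Definition idealQuot : preaddCat :=
  PreaddCat qcompA qcomp1m qcompm1 qcompDl qcompDr.

Definition quotFunctor : functor C idealQuot :=
  @Functor C idealQuot (fun A => A) qclass (fun A => erefl) qclassM.

End IdealQuotient.

Section Heart.
Variables (B : exactCat) (U V : addSub B).

Definition heart : preaddCat :=
  @fullSub (idealQuot (subW U V)) (in_H U V).

Definition pi_H : functor (fullSub (in_H U V)) heart :=
  @fcorestr (idealQuot (subW U V)) (in_H U V) _
    (frestr (in_H U V) (quotFunctor (subW U V))) (fun X => svalP X).

End Heart.

(* Main.v *)
From mathcomp Require Import all_boot all_algebra.
From mathcomp Require Import boolp.
Require Import Defs.

Set Implicit Arguments.
Unset Strict Implicit.
Unset Printing Implicit Defensive.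

Import GRing.Theory.
Local Open Scope ring_scope.
Local Open Scope cat_scope.

(** Write [W] for the intersection of [U] and [V], and call a morphism null when
it factors through [W].

The functor. Up to null morphisms every object [X] has a reflection
[alpha : X -> X+] in [B+] and a coreflection [beta : X- -> X] in [B-].
Coreflecting [X+] into [B-] and pulling back along [alpha] produces a
bicartesian square
    X-  --a-->    H X
    |beta         |b
    X  --alpha--> X+
in which [H X] lies in the heart, [a] is again a reflection and [b] a
coreflection ([heart_square_exists]). Hence for each [f : X -> Y] there is, up to
null morphisms, exactly one [h : H X -> H Y] for which [b h a] and
[alpha f beta] agree; this [h] is [H f] ([lifts_to_uniq]). For [X] in the heart
the square of identities is used, so that [H] restricts to the quotient functor
on the nose.

Half exactness ([hob_exact]). For a conflation [A >-> Y ->> C] pull [A >-> Y]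
back along [Y- ->> Y] to an inflation [A' >-> Y- >-> H Y], embed [A'] into some
[V1] in [V] with cokernel in [U], and let [D] be the pushout of [H Y] and [V1]
under [A']. The reflection of [D] is the cokernel of [H A -> H Y] in the heart.
As the kernel of [D -> H Y / A'] is [V1], and a deflation with kernel in [V]
induces one with the same kernel on suitable reflections ([urefl_V]), the
comparison from this cokernel to [H C] is monic. Together with the existence of
kernels ([heart_has_kernel]) this is exactness at [H Y].

Zeros ([hfunctor_zero]). [H] kills [U], because maps from [U] to [B+] are null,
and dually it kills [V]; half exactness then kills every extension of [V] by [U]
and every direct summand of one. Conversely, if [H X] is null then [X-] is in
[U], [X+] is in [V], and the bicartesian square is a conflation
[X- >-> H X + X ->> X+].

Uniqueness ([hfunctor_unique]). A half exact [G] killing [U] and [V] sends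
reflections and coreflections to morphisms that are monic and epic: each of them
is an inflation with cokernel in [U] (a deflation with kernel in [V]), and it
also occurs in a conflation coming from its defining pushout (pullback). The
heart is balanced ([heart_balanced]), so [G X <- G X- -> G (H X)] consists of
isomorphisms, and [G (H X)] is [H X].

Every notion involved is self-dual, exchanging [U] and [V]; half of the lemmas
are therefore obtained by applying the other half to the opposite exact
category. *)

(** * Opposite categories *)

Definition opP (C : preaddCat) : preaddCat :=
  @PreaddCat C (fun X Y => Hom Y X) (fun X => idm X)
    (fun X Y Z g f => f ∘ g)
    (fun _ _ _ _ h g f => esym (compmA f g h)) (fun _ _ f => compm1 f)
    (fun _ _ f => comp1m f) (fun _ _ _ g g' f => compmDr f g g')
    (fun _ _ _ g f f' => compmDl f f' g).

Lemma op_is_iso (C : preaddCat) (X Y : C) (f : Hom X Y) :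
  @is_iso (opP C) Y X f <-> is_iso f.
Proof. by split=> -[g [gf fg]]; exists g. Qed.

Lemma op_is_zero (C : preaddCat) (X : C) : @is_zero (opP C) X <-> is_zero X.
Proof. by split=> X0 Y; have [] := X0 Y; split. Qed.

Lemma op_is_biprod (C : preaddCat) (X Y S : C) (i1 : Hom X S) (i2 : Hom Y S)
    (p1 : Hom S X) (p2 : Hom S Y) :
  @is_biprod (opP C) X Y S p1 p2 i1 i2 <-> is_biprod i1 i2 p1 p2.
Proof. by split=> -[]; split. Qed.

Lemma op_sub_summand (C : preaddCat) (U : addSub C) (X Y S : opP C)
  (i1 : Hom X S) (i2 : Hom Y S) (p1 : Hom S X) (p2 : Hom S Y) :
  is_biprod i1 i2 p1 p2 -> U S -> U X.
Proof. by move=> /op_is_biprod; apply: (@sub_summand C). Qed.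

Lemma op_sub_biprod (C : preaddCat) (U : addSub C) (X Y S : opP C)
  (i1 : Hom X S) (i2 : Hom Y S) (p1 : Hom S X) (p2 : Hom S Y) :
  is_biprod i1 i2 p1 p2 -> U X -> U Y -> U S.
Proof. by move=> /op_is_biprod; apply: (@sub_biprod C). Qed.

Lemma op_sub_zero (C : preaddCat) (U : addSub C) (Z : opP C) :
  is_zero Z -> U Z.
Proof. by move=> /op_is_zero; apply: sub_zero. Qed.

Definition opSub (C : preaddCat) (U : addSub C) : addSub (opP C) :=
  @AddSub (opP C) U (@op_sub_zero C U) (@op_sub_biprod C U)
    (@op_sub_summand C U).

Lemma op_has_zero (C : addCat) : exists Z : opP C, is_zero Z.
Proof. by have [Z Z0] := has_zero C; exists Z; apply/op_is_zero. Qed.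

Lemma op_has_biprod (C : addCat) (X Y : opP C) :
  exists S (i1 : Hom X S) (i2 : Hom Y S) p1 p2, is_biprod i1 i2 p1 p2.
Proof.
have [S [i1 [i2 [p1 [p2 bS]]]]] := @has_biprod C X Y.
by exists S, p1, p2, i1, i2; apply/op_is_biprod.
Qed.

Definition opA (C : addCat) : addCat :=
  @AddCat (opP C) (op_has_zero C) (@op_has_biprod C).

Lemma conflation_iso_inv (B : exactCat) (X Y Z X' Y' Z' : B)
    (i : Hom X Y) (p : Hom Y Z) (i' : Hom X' Y') (p' : Hom Y' Z')
    (a : Hom X' X) (b : Hom Y' Y) (d : Hom Z' Z) :
  is_iso a -> is_iso b -> is_iso d -> i ∘ a = b ∘ i' -> p ∘ b = d ∘ p' ->
  conflation i p -> conflation i' p'.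
Proof.
move=> [a' [aa' a'a]] [b' [bb' b'b]] [d' [dd' d'd]] sq1 sq2.
apply: (@conflation_iso B _ _ _ _ _ _ _ _ _ _ a' b' d'); first by exists a.
- by exists b.
- by exists d.
- by rewrite -[i]compm1 -a'a (compmA i) sq1 2!compmA bb' comp1m.
- by rewrite -[p]compm1 -b'b (compmA p) sq2 2!compmA dd' comp1m.
Qed.

Section OppositeExact.
Variable B : exactCat.

Definition op_conflation (X Y Z : opA B) (i : Hom X Y) (p : Hom Y Z) :=
  @conflation B Z Y X p i.

Lemma op_kercoker (X Y Z : opA B) (i : Hom X Y) (p : Hom Y Z) :
  op_conflation i p -> is_kernel p i /\ is_cokernel i p.
Proof. by case/conflation_kercoker=> kip cip; split. Qed.

Lemma op_conflation_iso (X Y Z X' Y' Z' : opA B)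
    (i : Hom X Y) (p : Hom Y Z) (i' : Hom X' Y') (p' : Hom Y' Z')
    (a : Hom X X') (b : Hom Y Y') (d : Hom Z Z') :
  is_iso a -> is_iso b -> is_iso d -> b ∘ i = i' ∘ a -> d ∘ p = p' ∘ b ->
  op_conflation i p -> op_conflation i' p'.
Proof.
move=> /op_is_iso a_iso /op_is_iso b_iso /op_is_iso d_iso sq1 sq2.
exact: (conflation_iso_inv d_iso b_iso a_iso sq2 sq1).
Qed.

Definition opE : exactCat :=
  @ExactCat (opA B) op_conflation op_kercoker op_conflation_iso
    (@deflation_id B) (@inflation_id B)
    (fun X Y Z i j Hi Hj => @deflation_comp B Z Y X j i Hj Hi)
    (fun X Y Z i j Hi Hj => @inflation_comp B Z Y X j i Hj Hi)
    (fun X Y Z i a Hi => @deflation_pullback B Y X Z i a Hi)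
    (fun X Y Z i a Hi => @inflation_pushout B Y X Z i a Hi).

End OppositeExact.

(** * Exact categories *)

Lemma reassoc (C : preaddCat) (X Y Z : C) (g : Hom Y Z) (f : Hom X Y) h :
  g ∘ f = h -> forall T (k : Hom Z T), k ∘ g ∘ f = k ∘ h.
Proof. by move=> <- T k; rewrite compmA. Qed.

Lemma compmBl (C : preaddCat) (X Y Z : C) (g g' : Hom Y Z) (f : Hom X Y) :
  (g - g') ∘ f = g ∘ f - g' ∘ f.
Proof. by rewrite compmDl compNm. Qed.

Lemma compmBr (C : preaddCat) (X Y Z : C) (g : Hom Y Z) (f f' : Hom X Y) :
  g ∘ (f - f') = g ∘ f - g ∘ f'.
Proof. by rewrite compmDr compmN. Qed.

Lemma idm0_zero (C : preaddCat) (X : C) : idm X = 0 -> is_zero X.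
Proof.
by move=> X0 Y; split=> f;
  [rewrite -[f]compm1 | rewrite -[f]comp1m]; rewrite X0 ?compm0 ?comp0m.
Qed.

Section Conflation.
Variables (B : exactCat) (X Y Z : B) (i : Hom X Y) (p : Hom Y Z).
Hypothesis ip : conflation i p.

Lemma conf0 : p ∘ i = 0.
Proof. by have [[]] := conflation_kercoker ip. Qed.

Lemma conf_lift T (t : Hom T Y) : p ∘ t = 0 -> exists u, i ∘ u = t.
Proof.
by have [[_ kip] _] := conflation_kercoker ip; case/kip=> u [iu _]; exists u.
Qed.

Lemma conf_mono T (u v : Hom T X) : i ∘ u = i ∘ v -> u = v.
Proof.
have [[pi0 kip] _] := conflation_kercoker ip => iuv.
have [|w [_ wU]] := kip T (i ∘ v); first by rewrite compmA pi0 comp0m.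
by rewrite -(wU u) // -(wU v).
Qed.

Lemma conf_desc T (t : Hom Y T) : t ∘ i = 0 -> exists u, u ∘ p = t.
Proof.
by have [_ [_ cip]] := conflation_kercoker ip; case/cip=> u [iu _]; exists u.
Qed.

Lemma conf_epi T (u v : Hom Z T) : u ∘ p = v ∘ p -> u = v.
Proof.
have [_ [pi0 cip]] := conflation_kercoker ip => iuv.
have [|w [_ wU]] := cip T (v ∘ p); first by rewrite -compmA pi0 compm0.
by rewrite -(wU u) // -(wU v).
Qed.

Lemma conf_infl : inflation i. Proof. by exists Z, p. Qed.
Lemma conf_defl : deflation p. Proof. by exists X, i. Qed.

(** The cokernel witnessing that [i] is an inflation is isomorphic to any other
one, and conflations are closed under isomorphism. *)
Lemma conf_coker Z' (p' : Hom Y Z') : is_cokernel i p' -> conflation i p'.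
Proof.
case=> p'i0 cok; have [u up] := conf_desc p'i0.
have [v [vp vU]] := cok _ p conf0.
apply: (conflation_iso (a := idm X) (b := idm Y) (d := u) _ _ _ _ _ ip).
- by exists (idm X); rewrite comp1m.
- by exists (idm Y); rewrite comp1m.
- exists v; split; first by apply: conf_epi; rewrite -compmA up vp comp1m.
  have [w [_ wU]] := cok _ p' p'i0.
  by rewrite -(wU (u ∘ v)) ?(wU (idm _)) ?comp1m // -compmA vp up.
- by rewrite comp1m compm1.
- by rewrite up compm1.
Qed.

End Conflation.

Section Pushout.
Variables (B : exactCat) (X Y X' Y' : B) (i : Hom X Y) (a : Hom X X').
Variables (i' : Hom X' Y') (b : Hom Y Y').
Hypothesis po : is_pushout i a i' b.

Lemma po_sq : b ∘ i = i' ∘ a. Proof. by case: po. Qed.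

Lemma po_desc T (s : Hom Y T) (t : Hom X' T) :
  s ∘ i = t ∘ a -> exists u, u ∘ b = s /\ u ∘ i' = t.
Proof. by move=> st; have [u [uP _]] := po.2 _ _ _ st; exists u. Qed.

Lemma po_uniq T (u v : Hom Y' T) :
  u ∘ b = v ∘ b -> u ∘ i' = v ∘ i' -> u = v.
Proof.
move=> uvb uvi; have [|w [_ wU]] := po.2 T (v ∘ b) (v ∘ i').
  by rewrite -!compmA po_sq.
by rewrite -(wU u) // -(wU v).
Qed.

Lemma po_cok Z (p : Hom Y Z) : is_cokernel i p ->
  exists p' : Hom Y' Z, [/\ p' ∘ b = p, p' ∘ i' = 0 & is_cokernel i' p'].
Proof.
case=> pi0 cok; have [|p' [p'b p'i']] := @po_desc _ p 0.
  by rewrite pi0 comp0m.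
exists p'; split=> //; split=> // T t ti'0.
have [|u [uE uU]] := cok _ (t ∘ b).
  by rewrite -compmA po_sq compmA ti'0 comp0m.
exists u; split=> [|v vE]; last by apply: uU; rewrite -vE -compmA p'b.
by apply: po_uniq; rewrite -compmA ?p'b // p'i' compm0 ti'0.
Qed.

(** Both [b] and the cokernel of the composite inflation [i k] have the
universal property of the cokernel of [i k]. *)
Lemma po_defl K Z (k : Hom K X) (p : Hom Y Z) :
  conflation k a -> conflation i p -> conflation (i ∘ k) b.
Proof.
move=> ka ip.
have [Q [q]] : inflation (i ∘ k).
  by apply: inflation_comp; [exact: (conf_infl ka) | exact: (conf_infl ip)].
move/conf_coker; apply; split.
  by rewrite compmA po_sq -compmA (conf0 ka) compm0.
move=> T t tik; have [|u uE] := conf_desc ka (t := t ∘ i).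
  by rewrite -compmA.
have [v [vb vi']] := @po_desc _ t u (esym uE).
exists v; split=> // w wb; apply: po_uniq; first by rewrite vb.
by apply: (conf_epi ka); rewrite vi' uE -compmA -po_sq compmA wb.
Qed.

End Pushout.

Lemma po_conf (B : exactCat) (X Y Z X' : B) (i : Hom X Y) (p : Hom Y Z)
    (a : Hom X X') :
  conflation i p -> exists Y' (i' : Hom X' Y') (b : Hom Y Y') (p' : Hom Y' Z),
    [/\ is_pushout i a i' b, conflation i' p' & p' ∘ b = p].
Proof.
move=> ip; have [Y' [i' [b [po [Q [q i'q]]]]]] :=
  inflation_pushout a (conf_infl ip).
have [p' [p'b _ cok]] := po_cok po (proj2 (conflation_kercoker ip)).
by exists Y', i', b, p'; split=> //; exact (conf_coker i'q cok).
Qed.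

Lemma pb_conf (B : exactCat) (X Y Z Z' : B) (i : Hom X Y) (p : Hom Y Z)
    (d : Hom Z' Z) :
  conflation i p -> exists Y' (p' : Hom Y' Z') (b : Hom Y' Y) (i' : Hom X Y'),
    [/\ is_pullback p d p' b, conflation i' p' & b ∘ i' = i].
Proof. by move=> ip; exact (@po_conf (opE B) _ _ _ _ p i d ip). Qed.

Section Pullback.
Variables (B : exactCat) (Y Z Y' Z' : B) (p : Hom Y Z) (d : Hom Z' Z).
Variables (p' : Hom Y' Z') (b : Hom Y' Y).
Hypothesis pb : is_pullback p d p' b.

Lemma pb_sq : p ∘ b = d ∘ p'. Proof. by case: pb. Qed.

Lemma pb_lift T (s : Hom T Y) (t : Hom T Z') :
  p ∘ s = d ∘ t -> exists u, b ∘ u = s /\ p' ∘ u = t.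
Proof. by move=> st; have [u [uP _]] := pb.2 _ _ _ st; exists u. Qed.

Lemma pb_uniq T (u v : Hom T Y') :
  b ∘ u = b ∘ v -> p' ∘ u = p' ∘ v -> u = v.
Proof. exact (@po_uniq (opE B) _ _ _ _ p d p' b pb T u v). Qed.

Lemma pb_infl K X (k : Hom Z K) (i : Hom X Y) :
  conflation d k -> conflation i p -> conflation b (k ∘ p).
Proof.
move=> dk ip.
exact (@po_defl (opE B) _ _ _ _ p d p' b pb _ _ k i dk ip).
Qed.

End Pullback.

Lemma is_pullbackC (B : exactCat) (Y Z Y' Z' : B) (p : Hom Y Z) (d : Hom Z' Z)
    (p' : Hom Y' Z')
  (b : Hom Y' Y) : is_pullback p d p' b -> is_pullback d p b p'.
Proof.
case=> sq pb; split=> // T s t st; have [u [[u1 u2] uU]] := pb _ t s (esym st).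
by exists u; split=> // v [v1 v2]; apply: uU.
Qed.

Lemma is_pushoutC (B : exactCat) (X Y X' Y' : B) (i : Hom X Y) (a : Hom X X')
    (i' : Hom X' Y')
  (b : Hom Y Y') : is_pushout i a i' b -> is_pushout a i b i'.
Proof.
case=> sq po; split=> // T s t st; have [u [[u1 u2] uU]] := po _ t s (esym st).
by exists u; split=> // v [v1 v2]; apply: uU.
Qed.

(** The axiom provides one pushout whose side [i'] is an inflation; every other
pushout is isomorphic to it. *)
Lemma po_infl (B : exactCat) (X Y Z X' Y' : B) (i : Hom X Y) (p : Hom Y Z)
    (a : Hom X X') (i' : Hom X' Y') (b : Hom Y Y') :
  is_pushout i a i' b -> conflation i p ->
  exists p' : Hom Y' Z, conflation i' p' /\ p' ∘ b = p.
Proof.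
move=> po ip; have [P [j [c [q [po' jq qc]]]]] := po_conf a ip.
have [f [fc fj]] := po_desc po' (po_sq po).
have [g [gb gi]] := po_desc po (po_sq po').
have gf : g ∘ f = idm P.
  by apply: (po_uniq po'); rewrite -compmA ?fc ?fj ?gb ?gi comp1m.
have fg : f ∘ g = idm Y'.
  by apply: (po_uniq po); rewrite -compmA ?gb ?gi ?fc ?fj comp1m.
exists (q ∘ g); split; last by rewrite -compmA gb.
apply: (conflation_iso (a := idm _) (b := f) (d := idm _) _ _ _ _ _ jq).
- by exists (idm _); rewrite comp1m.
- by exists g.
- by exists (idm _); rewrite comp1m.
- by rewrite compm1 fj.
- by rewrite comp1m -compmA gf compm1.
Qed.

Lemma pb_defl (B : exactCat) (X Y Z Y' Z' : B) (i : Hom X Y) (p : Hom Y Z)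
    (d : Hom Z' Z) (p' : Hom Y' Z') (b : Hom Y' Y) :
  is_pullback p d p' b -> conflation i p ->
  exists i' : Hom X Y', conflation i' p' /\ b ∘ i' = i.
Proof.
by move=> pb ip; exact (@po_infl (opE B) _ _ _ _ _ p i d p' b pb ip).
Qed.

(** Short five lemma for two extensions of [Z] by [X]. On the pullback [R] of
[p'] and [p], the difference [q1 - f q2] of the two maps to [Y'] factors through
[i'], and correcting [q2] by this factor gives a map that descends along [q1] to
an inverse of [f]. *)
Lemma conf_five (B : exactCat) (X Y Z Y' : B) (i : Hom X Y) (p : Hom Y Z)
    (i' : Hom X Y')
    (p' : Hom Y' Z) (f : Hom Y Y') :
  conflation i p -> conflation i' p' -> f ∘ i = i' -> p' ∘ f = p -> is_iso f.
Proof.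
move=> ip ip' fi pf.
have [R [q1 [q2 [k [pb kq1 q2k]]]]] := pb_conf p' ip.
have [|r rE] := conf_lift ip' (t := q1 - f ∘ q2).
  by rewrite compmBr compmA pf (pb_sq pb) subrr.
have rk : r ∘ k = - idm X.
  apply: (conf_mono ip'); rewrite compmA rE compmBl (conf0 kq1) -compmA q2k fi.
  by rewrite compmN compm1 sub0r.
have [|g gE] := conf_desc kq1 (t := q2 + i ∘ r).
  by rewrite compmDl q2k -compmA rk compmN compm1 subrr.
have fg : f ∘ g = idm Y'.
  apply: (conf_epi kq1).
  by rewrite -compmA gE compmDr compmA fi rE comp1m addrC subrK.
exists g; split=> //.
have [|t tE] := conf_lift ip (t := g ∘ f - idm Y).
  by rewrite -pf -compmA compmBr compmA fg comp1m compm1 subrr compm0.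
suff t0 : t = 0 by apply/eqP; rewrite -subr_eq0 -tE t0 compm0.
apply: (conf_mono ip').
by rewrite compm0 -fi -compmA tE compmBr compmA fg comp1m compm1 subrr.
Qed.

(** A morphism of conflations which is the identity on cokernels is a pushout:
compare with an actual pushout by the short five lemma. *)
Lemma morph_po (B : exactCat) (X Y Z X' Y' : B) (i : Hom X Y) (p : Hom Y Z)
    (i' : Hom X' Y')
    (p' : Hom Y' Z) (a : Hom X X') (b : Hom Y Y') :
  conflation i p -> conflation i' p' -> b ∘ i = i' ∘ a -> p' ∘ b = p ->
  is_pushout i a i' b.
Proof.
move=> ip ip' sq pb.
have [P [j [c [q [po jq qc]]]]] := po_conf a ip.
have [f [fc fj]] := po_desc po sq.
have qf : p' ∘ f = q.
  apply: (po_uniq po); first by rewrite -compmA fc pb qc.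
  by rewrite -compmA fj (conf0 ip') (conf0 jq).
have [g [gf fg]] := conf_five jq ip' fj qf.
split=> // T s t st; have [u [uc uj]] := po_desc po st.
have gb : g ∘ b = c by rewrite -fc compmA gf comp1m.
have gi : g ∘ i' = j by rewrite -fj compmA gf comp1m.
exists (u ∘ g); split; first by rewrite -!compmA gb gi.
move=> v [vb vi]; rewrite -[v]compm1 -fg compmA; congr (_ ∘ g).
by apply: (po_uniq po); rewrite -compmA ?fc ?fj ?vb ?vi.
Qed.

Lemma morph_pb (B : exactCat) (X Y Z Y' Z' : B) (i : Hom X Y) (p : Hom Y Z)
    (i' : Hom X Y')
    (p' : Hom Y' Z') (b : Hom Y' Y) (d : Hom Z' Z) :
  conflation i p -> conflation i' p' -> p ∘ b = d ∘ p' -> b ∘ i' = i ->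
  is_pullback p d p' b.
Proof.
by move=> ip ip' sq bi;
  exact (@morph_po (opE B) _ _ _ _ _ p i p' i' d b ip ip' sq bi).
Qed.

Lemma conf_split (B : exactCat) (X Y Z : B) (i : Hom X Y) (p : Hom Y Z)
    (s : Hom Z Y) :
  conflation i p -> p ∘ s = idm Z -> exists r, is_biprod i s r p.
Proof.
move=> ip ps; have [|r rE] := conf_lift ip (t := idm Y - s ∘ p).
  by rewrite compmBr compmA ps compm1 comp1m subrr.
exists r; split=> //; first apply: (conf_mono ip).
- by rewrite compmA rE compmBl -compmA (conf0 ip) compm0 subr0 comp1m compm1.
- exact: (conf0 ip).
- apply: (conf_mono ip).
  by rewrite compmA rE compmBl -compmA ps compm1 comp1m subrr compm0.
- by rewrite rE subrK.
Qed.

Lemma biprodC (C : preaddCat) (X Y S : C) (i1 : Hom X S) (i2 : Hom Y S) p1 p2 :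
  is_biprod i1 i2 p1 p2 -> is_biprod i2 i1 p2 p1.
Proof. by case=> *; split=> //; rewrite addrC. Qed.

Lemma conf_cosplit (B : exactCat) (X Y Z : B) (i : Hom X Y) (p : Hom Y Z)
    (r : Hom Y X) :
  conflation i p -> r ∘ i = idm X -> exists s, is_biprod i s r p.
Proof.
move=> ip ri; have [s bS] := @conf_split (opE B) _ _ _ p i r ip ri.
by exists s; apply/op_is_biprod; exact: biprodC bS.
Qed.

(** Exhibiting the identity as a deflation provides its kernel, which is a
zero object. *)
Lemma zero_conf (B : exactCat) (X : B) :
  exists Z (k : Hom Z X), is_zero Z /\ conflation k (idm X).
Proof.
have [Z [k kX]] := deflation_id X; exists Z, k; split=> //.
apply: idm0_zero; apply: (conf_mono kX).
by rewrite compm0 compm1 -[k]comp1m (conf0 kX).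
Qed.

Lemma conf_zero (B : exactCat) (X : B) :
  exists Z (k : Hom X Z), is_zero Z /\ conflation (idm X) k.
Proof.
have [Z [k [Z0 kX]]] := @zero_conf (opE B) X.
by exists Z, k; split=> //; apply/op_is_zero.
Qed.

(** The defining conflation of a pushout along an inflation. It is obtained by
pulling back the cokernel [p'] of [i'] along the cokernel [p] of [i]; the map
[b] provides a splitting of the resulting extension of [Y] by [X']. *)
Lemma po_biprod (B : exactCat) (X Y Z X' Y' : B) (i : Hom X Y) (p : Hom Y Z)
    (a : Hom X X')
    (i' : Hom X' Y') (b : Hom Y Y') :
  is_pushout i a i' b -> conflation i p ->
  exists S (i1 : Hom Y S) (i2 : Hom X' S) p1 p2, is_biprod i1 i2 p1 p2 /\
    conflation (i1 ∘ i - i2 ∘ a) (b ∘ p1 + i' ∘ p2).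
Proof.
move=> po ip.
have [p' [ip' pb']] := po_infl po ip.
have [S [pi [be [la [pb laS be_la]]]]] := pb_conf p ip'.
have [k [kbe pik]] := pb_defl (is_pullbackC pb) ip.
have [|s [bes pis]] := pb_lift pb (s := b) (t := idm Y).
  by rewrite pb' compm1.
have [rho bS] := conf_split laS pis.
have [_ _ pila rhos sum1] := bS.
have beE : b ∘ pi + i' ∘ rho = be.
  rewrite -[RHS]compm1 -sum1 compmDr !compmA be_la bes; exact: addrC.
have kE : s ∘ i - la ∘ a = k.
  have rhok : rho ∘ k = - a.
    apply: (conf_mono ip'); rewrite compmN -(po_sq po) -pik !compmA.
    by apply/eqP; rewrite -addr_eq0 addrC -compmDl beE (conf0 kbe).
  rewrite -[RHS]comp1m -sum1 compmDl -!compmA rhok pik compmN addrC //.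
exists S, s, la, pi, rho; split; first exact: biprodC.
by rewrite beE kE.
Qed.

Lemma pb_biprod (B : exactCat) (X Y Z Y' Z' : B) (j : Hom X Y) (r : Hom Y Z)
    (u : Hom Z' Z) (b : Hom Y' Z') (w : Hom Y' Y) :
  is_pullback r u b w -> conflation j r ->
  exists S (i1 : Hom Y S) (i2 : Hom Z' S) p1 p2, is_biprod i1 i2 p1 p2 /\
    conflation (i1 ∘ w + i2 ∘ b) (r ∘ p1 - u ∘ p2).
Proof.
move=> pb jr.
have [S [i1 [i2 [p1 [p2 [bS cS]]]]]] :=
  @po_biprod (opE B) _ _ _ _ _ r j u b w pb jr.
by exists S, p1, p2, i1, i2; split=> //; apply/op_is_biprod.
Qed.

(** [S] is the pushout of [Y] and [X] under a zero object, hence an extension of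
[Y] by [X]. *)
Lemma biprod_conf (B : exactCat) (X Y S : B) (i1 : Hom X S) (i2 : Hom Y S)
    (p1 : Hom S X) (p2 : Hom S Y) :
  is_biprod i1 i2 p1 p2 -> conflation i1 p2.
Proof.
case=> p1i1 p2i2 p2i1 p1i2 sum1.
have [Z [z [Z0 zY]]] := zero_conf Y.
have po : is_pushout z (0 : Hom Z X) i1 i2.
  have Zeq T (u v : Hom Z T) : u = v.
    by rewrite (proj1 (Z0 T) u) (proj1 (Z0 T) v).
  split=> // T s t _; exists (s ∘ p2 + t ∘ p1); split.
    rewrite !compmDl -!compmA p1i1 p2i2 p2i1 p1i2.
    by rewrite !compm0 !compm1 addr0 add0r.
  by move=> u [<- <-]; rewrite -!compmA -compmDr addrC sum1 compm1.
have [p' [ip' p'i2]] := po_infl po zY.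
suff -> : p2 = p' by [].
by rewrite -[RHS]compm1 -sum1 compmDr !compmA
  (conf0 ip') p'i2 comp0m comp1m add0r.
Qed.

(** * Cotorsion pairs *)

Lemma op_cotorsion (B : exactCat) (U V : addSub B) :
  cotorsion_pair U V -> @cotorsion_pair (opE B) (opSub V) (opSub U).
Proof.
case=> ext pre env; split.
- move=> X Y VX UY E E' i p i' p' c c'.
  have [e [eI ei ep]] := ext Y X UY VX E' E p' i' p i c' c.
  by exists e; split=> //; apply/op_is_iso.
- by move=> X; have [VX [UX [i [p [v u c]]]]] := env X; exists UX, VX, p, i.
- by move=> X; have [VX [UX [i [p [v u c]]]]] := pre X; exists UX, VX, p, i.
Qed.

Lemma op_Bplus (B : exactCat) (U V : addSub B) (X : B) :
  @in_Bplus (opE B) (opSub V) (opSub U) X <-> in_Bminus U V X.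
Proof.
split.
  by move=> [A [E [i [p [H1 [H2 H2'] H3]]]]]; exists E, A, p, i; split.
by move=> [A [E [i [p [[H1 H1'] H2 H3]]]]]; exists E, A, p, i; split.
Qed.

Lemma op_Bminus (B : exactCat) (U V : addSub B) (X : B) :
  @in_Bminus (opE B) (opSub V) (opSub U) X <-> in_Bplus U V X.
Proof.
split.
  by move=> [A [E [i [p [[H1 H1'] H2 H3]]]]]; exists E, A, p, i; split.
by move=> [A [E [i [p [H1 [H2 H2'] H3]]]]]; exists E, A, p, i; split.
Qed.

(** Nullity is a predicate on the morphisms of [B], and not an equation in the
ideal quotient, because in this form it is literally self-dual: the quotient of
the opposite category is another type than the opposite of the quotient. *)
Definition null (B : exactCat) (U V : addSub B) (X Y : B) (f : Hom X Y) :=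
  factors_through (subW U V) f.

Lemma op_null (B : exactCat) (U V : addSub B) (X Y : B) (f : Hom X Y) :
  @null (opE B) (opSub V) (opSub U) Y X f <-> null U V f.
Proof. by split=> -[W [h [g [[w w'] ->]]]]; exists W, g, h; do 2!split. Qed.

Section Null.
Variables (B : exactCat) (U V : addSub B).
Implicit Types X Y Z T : B.
Local Notation null := (null U V).

Lemma null_compl X Y Z (f : Hom X Y) (g : Hom Y Z) : null f -> null (g ∘ f).
Proof. by case=> W [h [k [w ->]]]; exists W, h, (g ∘ k); rewrite compmA. Qed.

Lemma null_compr X Y Z (f : Hom X Y) (g : Hom Y Z) : null g -> null (g ∘ f).
Proof. by case=> W [h [k [w ->]]]; exists W, (h ∘ f), k; rewrite compmA. Qed.

Lemma null_W X Y W (h : Hom X W) (g : Hom W Y) : subW U V W -> null (g ∘ h).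
Proof. by move=> w; exists W, h, g. Qed.

Lemma nullB X Y (f g : Hom X Y) : null f -> null g -> null (f - g).
Proof.
move=> /asboolP nf /asboolP ng; apply/asboolP.
by have [_] := @factor_ideal_closed B (subW U V) X Y; apply.
Qed.

Lemma null0 X Y : null (0 : Hom X Y).
Proof.
by apply/asboolP; have [] := @factor_ideal_closed B (subW U V) X Y.
Qed.

Lemma nullN X Y (f : Hom X Y) : null f -> null (- f).
Proof. by move=> nf; rewrite -sub0r; apply: nullB => //; exact: null0. Qed.

Lemma nullD X Y (f g : Hom X Y) : null f -> null g -> null (f + g).
Proof. by move=> nf ng; rewrite -[g]opprK; apply/nullB/nullN. Qed.

Lemma nullBC X Y (f g : Hom X Y) : null (f - g) -> null (g - f).
Proof. by move/nullN; rewrite opprB. Qed.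

Lemma null_trans X Y (f g h : Hom X Y) :
  null (f - g) -> null (g - h) -> null (f - h).
Proof. by move=> fg gh; rewrite -[f](subrK g) -addrA; exact: nullD. Qed.

Lemma null_eq X Y (f g : Hom X Y) : null (f - g) -> null g -> null f.
Proof. by move=> fg gh; rewrite -[f](subrK g); exact: nullD. Qed.

Lemma null_refl X Y (f g : Hom X Y) : f = g -> null (f - g).
Proof. by move->; rewrite subrr; exact: null0. Qed.

Lemma null_l X Y Z (f f' : Hom X Y) (g : Hom Y Z) :
  null (f - f') -> null (g ∘ f - g ∘ f').
Proof. by move=> ff; rewrite -compmBr; exact: null_compl. Qed.

Lemma null_r X Y Z (f : Hom X Y) (g g' : Hom Y Z) :
  null (g - g') -> null (g ∘ f - g' ∘ f).
Proof. by move=> ff; rewrite -compmBl; exact: null_compr. Qed.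

End Null.

(** The extension obtained by pulling back is equivalent to the split one, here
built as a pushout of the conflation with zero kernel. *)
Lemma lift_UV (B : exactCat) (U V : addSub B) (uv : cotorsion_pair U V)
    (X V0 Y Z : B) (k : Hom V0 Y) (g : Hom Y Z) (f : Hom X Z) :
  U X -> V V0 -> conflation k g -> exists h, g ∘ h = f.
Proof.
move=> UX VV kg; have [P [g' [f' [k' [pb kg' fk]]]]] := pb_conf f kg.
have [Z0 [z [_ zX]]] := zero_conf X.
have [S [i [b [p [_ ip pbX]]]]] := po_conf (0 : Hom Z0 V0) zX.
have [ext _ _] := uv; have [e [_ ei pe]] := ext X V0 UX VV S P i p k' g' ip kg'.
exists (f' ∘ (e ∘ b)).
by rewrite compmA (pb_sq pb) -compmA [g' ∘ _]compmA pe pbX compm1.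
Qed.

Lemma ext_UV (B : exactCat) (U V : addSub B) (uv : cotorsion_pair U V)
    (X Y U0 Z : B) (i : Hom X Z) (q : Hom Z U0) (f : Hom X Y) :
  U U0 -> V Y -> conflation i q -> exists h, h ∘ i = f.
Proof.
move=> UU VY iq.
exact (@lift_UV (opE B) _ _ (op_cotorsion uv) Y U0 Z X q i f VY UU iq).
Qed.

(** A [U]-precover [p] of the middle term [Y] splits: a lift of [i] splits [p]
over [X], and the resulting retraction extends along the kernel of [q ∘ p],
whose cokernel [Z] lies in [U]. *)
Lemma U_ext (B : exactCat) (U V : addSub B) (uv : cotorsion_pair U V)
    (X Y Z : B) (i : Hom X Y) (q : Hom Y Z) :
  conflation i q -> U X -> U Z -> U Y.
Proof.
move=> iq UX UZ; have [_ pre _] := uv.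
have [VY [E [v [p [VV UE vp]]]]] := pre Y.
have [s sE] := lift_UV uv i UX VV vp.
have [K [k kq]] := deflation_comp (conf_defl vp) (conf_defl iq).
have [|c cE] := conf_lift iq (t := p ∘ k); first by rewrite compmA (conf0 kq).
have [|r rE] := conf_lift vp (t := k - s ∘ c).
  by rewrite compmBr compmA sE cE subrr.
have [r' r'E] := ext_UV uv r UZ VV kq.
have [|j jE] := conf_lift kq (t := v).
  by rewrite -compmA (conf0 vp) compm0.
have cj : c ∘ j = 0.
  apply: (conf_mono iq).
  by rewrite compmA cE -compmA jE (conf0 vp) compm0.
have r'v : r' ∘ v = idm VY.
  apply: (conf_mono vp).
  rewrite compm1 -[v in r' ∘ v]jE (compmA r') r'E compmA rE compmBl jE.
  by rewrite -compmA cj compm0 subr0.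
have [t bE] := conf_cosplit vp r'v.
by apply: (sub_summand (biprodC bE)).
Qed.

Lemma V_ext (B : exactCat) (U V : addSub B) (uv : cotorsion_pair U V)
    (X Y Z : B) (i : Hom X Y) (q : Hom Y Z) :
  conflation i q -> V X -> V Z -> V Y.
Proof.
move=> iq VX VZ.
exact (@U_ext (opE B) _ _ (op_cotorsion uv) Z Y X q i iq VZ VX).
Qed.

Section Cotorsion.
Variables (B : exactCat) (U V : addSub B).
Hypothesis uv : cotorsion_pair U V.
Implicit Types X Y Z T : B.
Local Notation null := (null U V).
Local Notation Bplus := (in_Bplus U V).
Local Notation Bminus := (in_Bminus U V).

(** Third isomorphism theorem: [D/X] is the pushout of [D] and [Y/X] under
[Y]. *)
Lemma noether_infl X Y Z D E (i1 : Hom X Y) (p1 : Hom Y Z) (i2 : Hom Y D)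
    (p2 : Hom D E) :
  conflation i1 p1 -> conflation i2 p2 ->
  exists F (m : Hom Z F) (q : Hom D F) (r : Hom F E),
    [/\ is_pushout i2 p1 m q, conflation (i2 ∘ i1) q, conflation m r
      & r ∘ q = p2].
Proof.
move=> c1 c2; have [F [m [q [r [po mr rq]]]]] := po_conf p1 c2.
by exists F, m, q, r; split=> //; exact (po_defl po c1 c2).
Qed.

(** The map lifts to the object of [W] covering [Y]. *)
Lemma U_to_Bplus X Y (f : Hom X Y) : U X -> Bplus Y -> null f.
Proof.
move=> UX [VY [WY [k [g [VV WW kg]]]]]; have [h <-] := lift_UV uv f UX VV kg.
exact: null_W.
Qed.

(** If [g i] factors as [k h] through [W], then [h] extends to a map [h'] on
[Y], the cokernel of [i] being in [U]; the difference of [g] and [k h'] factors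
through that cokernel, and maps from [U] to [B+] are null. *)
Lemma null_ext X Y U0 Z (i : Hom X Y) (q : Hom Y U0) (g : Hom Y Z) :
  conflation i q -> U U0 -> Bplus Z -> null (g ∘ i) -> null g.
Proof.
move=> iq UU BZ [W [h [k [[UW VW] giE]]]].
have [h' h'E] := ext_UV uv h UU VW iq.
have [|e eE] := conf_desc iq (t := g - k ∘ h').
  by rewrite compmBl giE -compmA h'E subrr.
apply: (null_eq (g := k ∘ h')); last exact: null_W.
by rewrite -eE; apply: null_compr; exact: U_to_Bplus.
Qed.

(** Embed the pushout [E] of [Y] and [WX] under [X], an object of [U], into an
object of [V]; the target is in [W], and the cokernel of [Y] in it is an
extension of objects of [U]. *)
Lemma Bminus_up X Y U0 (i : Hom X Y) (q : Hom Y U0) :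
  conflation i q -> U U0 -> Bminus X -> Bminus Y.
Proof.
move=> iq UU [WX [UX [w [p [[UW VW] UUX wp]]]]]; have [_ _ env] := uv.
have [E [w' [b [p' [po wp' pb]]]]] := po_conf i wp.
have [b' [bb' _]] := po_infl (is_pushoutC po) iq.
have UE := U_ext uv bb' UW UU.
have [VE [UE' [m [r [VV UE'U mr]]]]] := env E.
have [F [n [s [t [_ ms nt _]]]]] := noether_infl wp' mr.
exists VE, F, (m ∘ w'), s; split=> //; last exact: (U_ext uv nt).
by split=> //; exact: (U_ext uv mr).
Qed.

Lemma Bminus_down X Y U0 (i : Hom X Y) (q : Hom Y U0) :
  conflation i q -> U U0 -> Bminus Y -> Bminus X.
Proof.
move=> iq UU [WY [UY [w [p [WW UUY wp]]]]].
have [F [n [s [t [_ ms nt _]]]]] := noether_infl iq wp.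
by exists WY, F, (w ∘ i), s; split=> //; exact: (U_ext uv nt).
Qed.

Lemma Bplus_cover X VX WX (k : Hom VX WX) (g : Hom WX X) :
  V VX -> subW U V WX -> conflation k g -> Bplus X.
Proof. by exists VX, WX, k, g. Qed.

(** When [Y] lies in [B+], such an [a] is a reflection of [X] into [B+] modulo
null morphisms: any map from [X] to [B+] lifts over [U1], then extends to [W1]
and so to the pushout. The pushout is part of the definition, rather than the
universal property alone, since it also yields the conflation [U1 >-> W1 + X ->>
Y]. *)
Definition urefl X Y (a : Hom X Y) :=
  exists U1 W1 U0 (j : Hom U1 W1) (r : Hom W1 U0) (u : Hom U1 X)
    (w : Hom W1 Y),
    [/\ U U1, subW U V W1, U U0, conflation j r & is_pushout j u a w].

Definition vcorefl X Y (b : Hom X Y) :=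
  exists V1 W1 V0 (j : Hom V0 W1) (r : Hom W1 V1) (u : Hom Y V1)
    (w : Hom X W1),
    [/\ V V1, subW U V W1, V V0, conflation j r & is_pullback r u b w].

Lemma urefl_conf X Y (a : Hom X Y) : urefl a ->
  exists U0 (q : Hom Y U0), U U0 /\ conflation a q.
Proof.
move=> [U1 [W1 [U0 [j [r [u [w [_ _ UU jr po]]]]]]]].
by have [q [aq _]] := po_infl po jr; exists U0, q.
Qed.

Lemma urefl_ext X Y Z (a : Hom X Y) (g : Hom X Z) :
  urefl a -> Bplus Z -> exists h, h ∘ a = g.
Proof.
move=> [U1 [W1 [U0 [j [r [u [w [UU1 WW UU jr po]]]]]]]].
move=> [VZ [WZ [k [p [VV [UZ VZ'] kp]]]]].
have [l lE] := lift_UV uv (g ∘ u) UU1 VV kp.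
have [l' l'E] := ext_UV uv l UU VZ' jr.
have [|h [_ hE]] := po_desc po (s := p ∘ l') (t := g).
  by rewrite -compmA l'E.
by exists h.
Qed.

Lemma urefl_null X Y Z (a : Hom X Y) (h : Hom Y Z) :
  urefl a -> Bplus Z -> null (h ∘ a) -> null h.
Proof. by case/urefl_conf=> U0 [q [UU aq]]; exact: null_ext aq UU. Qed.

(** The standard reflection: push out the embedding [j] of a [U]-cover of [X]
into an object of [W] along that cover. The choices of [p] and [j] stay free, so
that those for two objects can be matched. *)
Lemma urefl_of X UX VX W0 U0 (v : Hom VX UX) (p : Hom UX X) (j : Hom UX W0)
    (r : Hom W0 U0) :
  conflation v p -> V VX -> U UX -> conflation j r -> V W0 -> U U0 ->
  exists Y (a : Hom X Y) (w : Hom W0 Y),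
    [/\ is_pushout j p a w, conflation (j ∘ v) w, urefl a & Bplus Y].
Proof.
move=> vp VV UU jr VW UU0; have UW := U_ext uv jr UU UU0.
have [Y [a [w [_ [po _ _]]]]] := po_conf p jr.
have jvw := po_defl po vp jr.
exists Y, a, w; split=> //; first by exists UX, W0, U0, j, r, p, w.
exact: (Bplus_cover VV _ jvw).
Qed.

Lemma urefl_exists X : exists Y (a : Hom X Y), urefl a /\ Bplus Y.
Proof.
have [_ pre env] := uv.
have [VX [UX [v [p [VV UU vp]]]]] := pre X.
have [W0 [U0 [j [r [VW UU0 jr]]]]] := env UX.
have [Y [a [w [_ _ ra BY]]]] := urefl_of vp VV UU jr VW UU0.
by exists Y, a.
Qed.

End Cotorsion.

Lemma op_urefl (B : exactCat) (U V : addSub B) (X Y : B) (b : Hom X Y) :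
  @urefl (opE B) (opSub V) (opSub U) Y X b <-> vcorefl U V b.
Proof.
split; move=> [V1 [W1 [V0 [j [r [u [w [VV [WW WW'] VV0 jr pb]]]]]]]].
  by exists V1, W1, V0, r, j, u, w; split.
by exists V1, W1, V0, r, j, u, w; split.
Qed.

Section DualCotorsion.
Variables (B : exactCat) (U V : addSub B).
Hypothesis uv : cotorsion_pair U V.
Implicit Types X Y Z T : B.
Local Notation null := (null U V).
Local Notation Bplus := (in_Bplus U V).
Local Notation Bminus := (in_Bminus U V).
Local Notation urefl := (urefl U V).
Local Notation vcorefl := (vcorefl U V).
Let uv' := op_cotorsion uv.

Lemma noether_defl X Y Z D E (i1 : Hom X Y) (p1 : Hom Y Z) (i2 : Hom D E)
    (p2 : Hom E Y) :
  conflation i1 p1 -> conflation i2 p2 ->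
  exists F (m : Hom F X) (q : Hom F E) (r : Hom D F),
    [/\ is_pullback p2 i1 m q, conflation q (p1 ∘ p2), conflation r m
      & q ∘ r = i2].
Proof.
move=> c1 c2.
exact (@noether_infl (opE B) _ _ _ _ _ p1 i1 p2 i2 c1 c2).
Qed.

Lemma null_lift T X Y V0 (k : Hom V0 X) (g : Hom X Y) (t : Hom T X) :
  conflation k g -> V V0 -> Bminus T -> null (g ∘ t) -> null t.
Proof.
move=> kg VV /op_Bplus BT /op_null nt; apply/op_null.
exact (@null_ext (opE B) _ _ uv' Y X V0 T g k t kg VV BT nt).
Qed.

Lemma Bplus_up X Y V0 (k : Hom V0 X) (g : Hom X Y) :
  conflation k g -> V V0 -> Bplus Y -> Bplus X.
Proof.
move=> kg VV /op_Bminus BY; apply/op_Bminus.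
exact (@Bminus_up (opE B) _ _ uv' Y X V0 g k kg VV BY).
Qed.

Lemma vcorefl_conf X Y (b : Hom X Y) : vcorefl b ->
  exists V0 (k : Hom V0 X), V V0 /\ conflation k b.
Proof.
by move=> /op_urefl rb; exact (@urefl_conf (opE B) _ _ Y X b rb).
Qed.

Lemma vcorefl_lift X Y T (b : Hom X Y) (t : Hom T Y) :
  vcorefl b -> Bminus T -> exists h, b ∘ h = t.
Proof.
move=> /op_urefl rb /op_Bplus BT.
exact (@urefl_ext (opE B) _ _ uv' Y X T b t rb BT).
Qed.

Lemma vcorefl_null X Y T (b : Hom X Y) (t : Hom T X) :
  vcorefl b -> Bminus T -> null (b ∘ t) -> null t.
Proof. by case/vcorefl_conf=> V0 [k [VV kb]]; exact: null_lift kb VV. Qed.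

Lemma vcorefl_exists Y : exists X (b : Hom X Y), vcorefl b /\ Bminus X.
Proof.
have [X [b [rb BX]]] := @urefl_exists (opE B) _ _ uv' Y.
by exists X, b; split; [exact/op_urefl | exact/op_Bplus].
Qed.

Lemma Bminus_to_V T X (f : Hom T X) : Bminus T -> V X -> null f.
Proof.
move=> /op_Bplus BT VX; apply/op_null.
exact (@U_to_Bplus (opE B) _ _ uv' X T f VX BT).
Qed.

Lemma vcorefl_of X V1 U1 W0 V0 (l : Hom X V1) (s : Hom V1 U1)
    (j : Hom V0 W0) (r : Hom W0 V1) :
  conflation l s -> U U1 -> V V1 -> conflation j r -> U W0 -> V V0 ->
  exists Y (b : Hom Y X) (w : Hom Y W0),
    [/\ is_pullback r l b w, conflation w (s ∘ r), vcorefl b & Bminus Y].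
Proof.
move=> ls UU VV jr UW VV0.
have [Y [b [w [pb wsr rb BY]]]] :=
  @urefl_of (opE B) _ _ uv' X V1 U1 W0 V0 s l r j ls UU VV jr UW VV0.
by exists Y, b, w; split=> //; [exact/op_urefl | exact/op_Bplus].
Qed.

(** The kernel [F] of [E ->> X ->> Y] is an extension of objects of [V], so a
[U]-precover [E] of [X] also serves for [Y]; the induced map between the
reflections is then a deflation with the kernel of [g]. *)
Lemma urefl_V X Y V0 (k : Hom V0 X) (g : Hom X Y) :
  conflation k g -> V V0 ->
  exists X' Y' (a : Hom X X') (a' : Hom Y Y') (g' : Hom X' Y') (k' : Hom V0 X'),
    [/\ urefl a /\ Bplus X', urefl a' /\ Bplus Y', g' ∘ a = a' ∘ g
      & conflation k' g'].
Proof.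
move=> kg VV0; have [_ pre env] := uv.
have [VX [E [v [p [VV UE vp]]]]] := pre X.
have [F [m [q [r [_ qgp rm _]]]]] := noether_defl kg vp.
have VF : V F by exact: (V_ext uv rm).
have [W0 [U0 [j [s [VW UU0 js]]]]] := env E.
have WW : subW U V W0 by split=> //; exact: (U_ext uv js).
have [X' [a [w [po _ ra BX]]]] := urefl_of uv vp VV UE js VW UU0.
have [c [ac cw]] := po_infl po js.
have [Y' [a' [g' [c' [po' ac' cg]]]]] := po_conf g ac.
have po2 : is_pushout j (g ∘ p) a' (g' ∘ w).
  apply: (morph_po js ac').
    by rewrite -compmA (po_sq po) !compmA (po_sq po').
  by rewrite compmA cg cw.
exists X', Y', a, a', g', (a ∘ k); split=> //.
- split; first by exists E, W0, U0, j, s, (g ∘ p), (g' ∘ w).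
  exact: Bplus_cover VF WW (po_defl po2 qgp js).
- exact: po_sq po'.
- exact (po_defl po' kg ac).
Qed.

End DualCotorsion.

Lemma addUV_U (B : exactCat) (U V : addSub B) (X : B) : U X -> in_addUV U V X.
Proof.
move=> UX; have [Z [k [Z0 kX]]] := conf_zero X.
exists Z, X, (idm X), 0, (idm X), 0; split; last first.
  by exists X, Z, (idm X), k; split=> //; exact: sub_zero.
split; rewrite ?comp1m ?compm0 ?comp0m ?addr0 //.
by rewrite (proj1 (Z0 _) (idm Z)).
Qed.

Lemma addUV_V (B : exactCat) (U V : addSub B) (X : B) : V X -> in_addUV U V X.
Proof.
move=> VX; have [Z [k [Z0 kX]]] := zero_conf X.
exists Z, X, (idm X), 0, (idm X), 0; split; last first.
  by exists Z, X, k, (idm X); split=> //; exact: sub_zero.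
split; rewrite ?comp1m ?compm0 ?comp0m ?addr0 //.
by rewrite (proj1 (Z0 _) (idm Z)).
Qed.

(** * The heart as a reflection of a coreflection *)

Section HeartSquare.
Variables (B : exactCat) (U V : addSub B).
Implicit Types X Y Z T : B.

(** The square [b a = alpha beta] through which [H X], here [hob], is defined.
The two factorizations of [X- -> X+] make [hob] both the reflection of [X-] and
the coreflection of [X+]. *)
Record heart_square X := HeartSquare {
  hminus : B; hob : B; hplus : B;
  hbeta : Hom hminus X; halpha : Hom X hplus;
  ha : Hom hminus hob; hb : Hom hob hplus;
  hbeta_corefl : vcorefl U V hbeta; halpha_refl : urefl U V halpha;
  ha_refl : urefl U V ha; hb_corefl : vcorefl U V hb;
  h_po : is_pushout ha hbeta halpha hb;
  hplusP : in_Bplus U V hplus; hminusP : in_Bminus U V hminus;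
  hobP : in_H U V hob }.

(** Commutation is required strictly, and with the two arrows out of [X-] only:
then the representatives [h] of [H f] compose strictly, and other functors can
be applied to the squares. The condition on [b h a] that determines
[h] up to null morphisms follows, see [lifts_to_sq]. *)
Definition lifts_to X Y (dX : heart_square X) (dY : heart_square Y)
    (f : Hom X Y)
    (h : Hom (hob dX) (hob dY)) :=
  exists f' : Hom (hminus dX) (hminus dY),
    hbeta dY ∘ f' = f ∘ hbeta dX /\ h ∘ ha dX = ha dY ∘ f'.

Lemma urefl_idm X : urefl U V (idm X).
Proof.
have [Z Z0] := has_zero B; have [Z' [j [Z0' jZ]]] := zero_conf Z.
exists Z', Z, Z, j, (idm Z), 0, 0; split=> //; try exact: sub_zero.
split; first by rewrite comp0m compm0.
move=> T s t _; exists t; split; last by move=> u [_ <-]; rewrite compm1.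
by rewrite compm1 compm0; split=> //; rewrite (proj1 (Z0 _) s).
Qed.

End HeartSquare.

Arguments lifts_to {B U V X Y} dX dY f h.

Lemma vcorefl_idm (B : exactCat) (U V : addSub B) (X : B) : vcorefl U V (idm X).
Proof. exact/op_urefl/urefl_idm. Qed.

Section HeartSquareTheory.
Variables (B : exactCat) (U V : addSub B).
Hypothesis uv : cotorsion_pair U V.
Implicit Types X Y Z T : B.
Local Notation null := (null U V).
Local Notation Bplus := (in_Bplus U V).
Local Notation Bminus := (in_Bminus U V).
Local Notation heart_square := (heart_square U V).

Lemma is_pushout_idm X : is_pushout (idm X) (idm X) (idm X) (idm X).
Proof.
split=> // T s t; rewrite !compm1 => <-; exists s.
by split=> [|u [<-]]; rewrite compm1.
Qed.

Definition heart_square_H X (HX : in_H U V X) : heart_square X :=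
  HeartSquare (vcorefl_idm U V X) (urefl_idm U V X) (urefl_idm U V X)
    (vcorefl_idm U V X) (is_pushout_idm X) (proj1 HX) (proj2 HX) HX.

(** Reflect [X], coreflect the result, and pull back. The pullback [a] of the
inflation [alpha] along the deflation [b] is an inflation with the same cokernel
in [U], and it inherits from [alpha] the structure of a reflection since [W0 ->
X'] lifts along [b]. *)
Lemma heart_square_exists X : exists d : heart_square X, True.
Proof.
have [_ pre env] := uv.
have [VX [UX [v [p [VV UU vp]]]]] := pre X.
have [W0 [U0 [j [r [VW UU0 jr]]]]] := env UX.
have UW0 : U W0 by exact: (U_ext uv jr).
have [Xp [al [w0 [po _ ral BXp]]]] := urefl_of uv vp VV UU jr VW UU0.
have [q [alq qw]] := po_infl po jr.
have [HX [b [rb BmHX]]] := vcorefl_exists uv Xp.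
have [V1 [W1 [V0 [j1 [r1 [u1 [w1 [VV1 WW1 VV0 jr1 pb1]]]]]]]] := rb.
have [k [kb wk]] := pb_defl pb1 jr1.
have [Xm [be [a [k' [pb kbe ak]]]]] := pb_conf al kb.
have aqb : conflation a (q ∘ b) by exact (pb_infl pb alq kb).
have [w wE] := lift_UV uv w0 UW0 VV0 kb.
have [|u uE] := conf_lift aqb (t := w ∘ j).
  by rewrite -compmA (compmA b) wE compmA qw (conf0 jr).
have rbe : vcorefl U V be.
  exists V1, W1, V0, j1, r1, (u1 ∘ al), (w1 ∘ a); split=> //.
  apply: (morph_pb jr1 kbe); last by rewrite -compmA ak.
  by rewrite compmA (pb_sq pb1) -compmA (pb_sq pb) compmA.
have ra : urefl U V a.
  exists UX, W0, U0, j, r, u, w; split=> //.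
  by apply: (morph_po jr aqb); rewrite -?uE // -compmA wE.
have HH : in_H U V HX by split=> //; exact: (Bplus_up uv kb).
have BXm : Bminus Xm by exact: (Bminus_down uv aqb).
have poH : is_pushout a be al b by exact: (morph_po aqb alq (pb_sq pb)).
by exists (HeartSquare rbe ral ra rb poH BXp BXm HH).
Qed.

Section Maps.
Variables (X Y : B) (dX : heart_square X) (dY : heart_square Y).

Lemma lifts_to_exists (f : Hom X Y) : exists h, lifts_to dX dY f h.
Proof.
have [f' f'E] :=
  vcorefl_lift uv (f ∘ hbeta dX) (hbeta_corefl dY) (hminusP dX).
have [h hE] := urefl_ext uv (ha dY ∘ f') (ha_refl dX) (proj1 (hobP dY)).
by exists h, f'.
Qed.

(** [ha] is epic and [hb] monic up to null morphisms. *)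
Lemma null_of_square (h : Hom (hob dX) (hob dY)) :
  null (hb dY ∘ h ∘ ha dX) -> null h.
Proof.
move=> /(urefl_null uv (ha_refl dX) (hplusP dY)).
exact: (vcorefl_null uv (hb_corefl dY) (proj2 (hobP dX))).
Qed.

Lemma lifts_to_sq (f : Hom X Y) h :
  lifts_to dX dY f h -> hb dY ∘ h ∘ ha dX = halpha dY ∘ f ∘ hbeta dX.
Proof.
move=> [f' [be_f hE]].
by rewrite -compmA hE compmA (po_sq (h_po dY)) -!compmA be_f.
Qed.

Lemma lifts_to_uniq (f : Hom X Y) h h' :
  lifts_to dX dY f h -> lifts_to dX dY f h' -> null (h - h').
Proof.
move=> /lifts_to_sq hE /lifts_to_sq h'E; apply: null_of_square.
by rewrite compmBr compmBl hE h'E; exact: null_refl.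
Qed.

End Maps.

Lemma lifts_to_id X (dX : heart_square X) : lifts_to dX dX (idm X) (idm _).
Proof. by exists (idm _); rewrite !comp1m !compm1. Qed.

Lemma lifts_to_comp X Y Z (dX : heart_square X) (dY : heart_square Y)
    (dZ : heart_square Z)
    (f : Hom X Y) (g : Hom Y Z) h k :
  lifts_to dX dY f h -> lifts_to dY dZ g k -> lifts_to dX dZ (g ∘ f) (k ∘ h).
Proof.
move=> [f' [bf hf]] [g' [bg hg]]; exists (g' ∘ f').
by rewrite compmA bg -!compmA bf hf !compmA hg.
Qed.

Lemma hob_null_U X (dX : heart_square X) : U X -> null (idm (hob dX)).
Proof.
move=> UX; apply: (@null_of_square X X);
  rewrite (lifts_to_sq (lifts_to_id dX)) compm1.
by apply: null_compr; apply: (U_to_Bplus uv) => //; exact: hplusP.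
Qed.

Lemma hob_null_V X (dX : heart_square X) : V X -> null (idm (hob dX)).
Proof.
move=> VX; apply: (@null_of_square X X);
  rewrite (lifts_to_sq (lifts_to_id dX)) compm1.
by apply: null_compl; apply: (Bminus_to_V uv) => //; exact: hminusP.
Qed.

(** A plain retract of an object of [W] need not be a direct summand; but here
the retraction makes the given cover of [Y] by an object of [W] split. *)
Lemma Bplus_W Y : Bplus Y -> null (idm Y) -> subW U V Y.
Proof.
move=> [VY [WY [k [p [VV WW kp]]]]] [W [h [g [[UW _] idE]]]].
have [s sE] := lift_UV uv g UW VV kp.
have [|t bY] := conf_split kp (s := s ∘ h); first by rewrite compmA sE idE.
exact: (sub_summand (biprodC bY)).
Qed.

(** [X] is a direct summand of an extension of [Y] by an object of [U]. *)
Lemma urefl_U X Y (a : Hom X Y) : urefl U V a -> U Y -> U X.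
Proof.
move=> [U1 [W1 [U0 [j [r [u [w [UU1 WW UU jr po]]]]]]]] UY.
have [S [i1 [i2 [p1 [p2 [bS cS]]]]]] := po_biprod po jr.
by apply: (sub_summand (biprodC bS)); exact: (U_ext uv cS).
Qed.

End HeartSquareTheory.

Section Kernel.
Variables (B : exactCat) (U V : addSub B).
Hypothesis uv : cotorsion_pair U V.
Implicit Types X Y Z T : B.
Local Notation null := (null U V).
Local Notation Bplus := (in_Bplus U V).
Local Notation Bminus := (in_Bminus U V).
Local Notation heart_square := (heart_square U V).

Lemma vcorefl_V X Y (b : Hom X Y) : vcorefl U V b -> V X -> V Y.
Proof.
move=> /op_urefl rb VX.
exact (@urefl_U (opE B) _ _ (op_cotorsion uv) Y X b rb VX).
Qed.

(** If [H X] is null then [X-] is in [U] and [X+] in [V], and the defining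
square of [H X] gives a conflation with middle term [H X + X]. *)
Lemma hob_null_addUV X (d : heart_square X) : 
  null (idm (hob d)) -> in_addUV U V X.
Proof.
move=> /(Bplus_W uv (proj1 (hobP d))) [UH VH].
have Um := urefl_U uv (ha_refl d) UH.
have Vp := vcorefl_V (hb_corefl d) VH.
have [U0 [q [UU aq]]] := urefl_conf (ha_refl d).
have [S [i1 [i2 [p1 [p2 [bS cS]]]]]] := po_biprod (h_po d) aq.
exists (hob d), S, i2, i1, p2, p1; split; first exact: biprodC.
by exists (hminus d), (hplus d), (i1 ∘ ha d - i2 ∘ hbeta d),
  (hb d ∘ p1 + halpha d ∘ p2).
Qed.

(** [A'] is the pullback of [f] along [hbeta dY], and [D] is the pushout of [hob
dY] and an object [V1] of [V] under [A']; it maps onto the cokernel [C'] of [A'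
>-> hob dY] with kernel [V1]. The reflection [Q] of [D] is the cokernel of [h].
The map [Q -> C''] induced on reflections by [D ->> C'] is monic up to null
morphisms, and it factors through any comparison [c'], which is therefore monic
as well. *)
Lemma hob_exact A Y C (f : Hom A Y) (g : Hom Y C) (dA : heart_square A)
    (dY : heart_square Y)
    (dC : heart_square C) h k :
  conflation f g -> lifts_to dA dY f h -> lifts_to dY dC g k ->
  exists Q (c : Hom (hob dY) Q),
    [/\ in_H U V Q, null (c ∘ h),
        forall Z (s : Hom (hob dY) Z), Bplus Z -> null (s ∘ h) ->
          exists s', s' ∘ c = s,
        forall Z (s : Hom Q Z), Bplus Z -> null (s ∘ c) -> null s
      & forall c' : Hom Q (hob dC), null (c' ∘ c - k) ->
        forall T (t : Hom T Q), Bminus T -> null (c' ∘ t) -> null t].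
Proof.
move=> fg [fm [fmE hE]] [gm [gmE kE]].
have [_ pre env] := uv.
have [Vb [kb [VVb kbb]]] := vcorefl_conf (hbeta_corefl dY).
have [A' [e0 [m [r0 [pbA mg _ _]]]]] := noether_defl fg kbb.
have [U0 [q0 [UU0 aq]]] := urefl_conf (ha_refl dY).
have [C' [n [g' [r1 [poC amg _ _]]]]] := noether_infl mg aq.
have [V1 [U1 [l [s [VV1 UU1 ls]]]]] := env A'.
have [V0 [W0 [j [r [VV0 UW0 jr]]]]] := pre V1.
have [Am [b [w [pbm wsr rb BAm]]]] := vcorefl_of uv ls UU1 VV1 jr UW0 VV0.
have pom : is_pushout w b l r by exact: (morph_po wsr ls (pb_sq pbm)).
have [D [io [v [p' [poD iop pv]]]]] := po_conf (ha dY ∘ m) ls.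
have BD : Bminus D := Bminus_up uv iop UU1 (proj2 (hobP dY)).
have [d [vd dio]] := po_infl (is_pushoutC poD) amg.
have [Q [C'' [aD [aC [d' [k' [[raD BQ] [raC BC''] dE kd]]]]]]] :=
  urefl_V uv vd VV1.
have [UD [qD [UUD aDq]]] := urefl_conf raD.
have uniq Z (t : Hom Q Z) : Bplus Z -> null (t ∘ (aD ∘ io)) -> null t.
  move=> BZ; rewrite compmA => /(null_ext uv iop UU1 BZ).
  exact: (urefl_null uv raD BZ).
exists Q, (aD ∘ io); split=> //.
- by split=> //; exact: (Bminus_up uv aDq).
(* On [hminus dA] the composite passes through [V1], and maps from [B-] to [V] are
   null. *)
- apply: (urefl_null uv (ha_refl dA) BQ); rewrite -compmA hE.
  have [|u [mu _]] := pb_lift pbA (s := fm) (t := hbeta dA) => //.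
  have -> : aD ∘ io ∘ (ha dY ∘ fm) = aD ∘ (v ∘ (l ∘ u)).
    by rewrite -mu -!compmA [v ∘ (l ∘ u)]compmA (po_sq poD) !compmA.
  do 2!apply: null_compl.
  by apply: (Bminus_to_V uv) => //; exact: hminusP.
(* On the coreflection [Am] of [A'] the composite is null, so it extends to [W0];
   as the square of [Am], [A'], [W0] and [V1] is a pushout, the composite on [A']
   extends to [V1]. *)
- move=> Z t BZ th.
  have [e eE] := vcorefl_lift uv (e0 ∘ b) (hbeta_corefl dA) BAm.
  have nme : null (m ∘ b - fm ∘ e).
    apply: (vcorefl_null uv (hbeta_corefl dY) BAm); rewrite compmBr !compmA fmE.
    by rewrite (pb_sq pbA) -!compmA eE; exact: null_refl.
  have [W2 [x [y [[_ VW2] tE]]]] : null (t ∘ ha dY ∘ m ∘ b).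
    rewrite -compmA; apply: (null_eq (null_l _ nme)).
    by rewrite compmA -(compmA t) -hE compmA -compmA; exact: null_compr.
  have [x' xE] := ext_UV uv x UU1 VW2 wsr.
  have [|s1 [_ s1E]] := po_desc pom (s := y ∘ x') (t := t ∘ ha dY ∘ m).
    by rewrite -compmA xE.
  have [|t1 [_ t1E]] := po_desc poD (s := s1) (t := t).
    by rewrite s1E compmA.
  have [t2 t2E] := urefl_ext uv t1 raD BZ.
  by exists t2; rewrite compmA t2E.
(* The induced map [d' : Q -> C''] agrees with [n' b c'] up to a null map, since
   both agree on [hminus dY]. *)
- move=> c' cE T t BT ct.
  have [n' nE] := urefl_ext uv (aC ∘ n) (halpha_refl dC) BC''.
  have dn : null (d' - n' ∘ hb dC ∘ c').
    apply: uniq => //; rewrite compmBl compmA dE.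
    apply: (@null_trans _ _ _ _ _ _ (n' ∘ hb dC ∘ k)); last first.
      rewrite -(compmA (n' ∘ hb dC)); apply: null_l; exact: nullBC.
    apply: (urefl_null uv (ha_refl dY) BC''); rewrite compmBl.
    apply: null_refl; rewrite -(compmA aC) dio -!compmA (po_sq poC) kE.
    rewrite (compmA (hb dC)) (po_sq (h_po dC)) -compmA gmE.
    by rewrite !compmA nE.
  apply: (null_lift uv kd VV1 BT); apply: (null_eq (null_r t dn)).
  by rewrite -compmA; exact: null_compl.
Qed.

End Kernel.

(** * Kernels and isomorphisms in the heart *)

Lemma op_in_H (B : exactCat) (U V : addSub B) (X : B) :
  @in_H (opE B) (opSub V) (opSub U) X <-> in_H U V X.
Proof.
by split=> -[]; [move/op_Bplus => ? /op_Bminus | move/op_Bminus => ? /op_Bplus].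
Qed.

Section EpiU.
Variables (B : exactCat) (U V : addSub B).
Hypothesis uv : cotorsion_pair U V.
Implicit Types X Y Z T : B.
Local Notation null := (null U V).

(** The reflection of [D] is the cokernel of [f] in the heart; when it is null
it lies in [W], and then [D] lies in [U]. *)
Lemma epi_U X Y WX UX D (f : Hom X Y) (w : Hom X WX) (p : Hom WX UX)
    (i : Hom Y D) (b : Hom WX D) :
  in_H U V Y -> subW U V WX -> U UX -> conflation w p -> is_pushout w f i b ->
  (forall Z (s : Hom Y Z), in_H U V Z -> null (s ∘ f) -> null s) -> U D.
Proof.
move=> [_ BY] WW UU wp po epi; have [p' [ip' _]] := po_infl po wp.
have [Q [a [ra BQ]]] := urefl_exists uv D.
apply: (urefl_U uv ra); suff [] : subW U V Q by [].
apply: (Bplus_W uv BQ); apply: (urefl_null uv ra BQ); rewrite comp1m.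
apply: (null_ext uv ip' UU BQ); apply: epi; last first.
  by rewrite -compmA -(po_sq po) compmA; exact: null_W.
split=> //; have [U0 [q [UU0 aq]]] := urefl_conf ra.
exact: (Bminus_up uv aq UU0 (Bminus_up uv ip' UU BY)).
Qed.

End EpiU.

Section Heart.
Variables (B : exactCat) (U V : addSub B).
Hypothesis uv : cotorsion_pair U V.
Implicit Types X Y Z T : B.
Local Notation null := (null U V).

Lemma mono_V X Y VY WY K (f : Hom X Y) (k : Hom VY WY) (p : Hom WY Y)
    (m : Hom K X) (b : Hom K WY) :
  in_H U V X -> subW U V WY -> V VY -> conflation k p -> is_pullback p f m b ->
  (forall T (t : Hom T X), in_H U V T -> null (f ∘ t) -> null t) -> V K.
Proof.
move=> /op_in_H HX [UW VW] VV kp pb mono.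
apply: (@epi_U (opE B) _ _ (op_cotorsion uv) Y X WY VY K f p k m b HX _
  VV kp pb).
  by [].
by move=> T t /op_in_H HT /op_null ft; apply/op_null; exact: mono.
Qed.

(** The kernel is the coreflection in [B-] of the pullback along [f] of a cover
of [Y] by an object of [W]. *)
Lemma heart_kernel X Y (f : Hom X Y) : in_H U V X -> in_Bplus U V Y ->
  exists K (m : Hom K X),
    [/\ in_H U V K, null (f ∘ m),
        forall T (t : Hom T X), in_Bminus U V T -> null (f ∘ t) ->
          exists t', m ∘ t' = t
      & forall T (t : Hom T K), in_Bminus U V T -> null (m ∘ t) -> null t].
Proof.
move=> [BX _] [VY [WY [k [p [VV [UW VW] kp]]]]].
have [K1 [m1 [b [k' [pb km _]]]]] := pb_conf f kp.
have [K [c [rc BK]]] := vcorefl_exists uv K1.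
have [V0 [kc [VV0 kcc]]] := vcorefl_conf rc.
exists K, (m1 ∘ c); split.
- by split=> //; exact: (Bplus_up uv kcc VV0 (Bplus_up uv km VV BX)).
- by rewrite compmA -(pb_sq pb) -compmA; exists WY, (b ∘ c), p.
- move=> T t BT [W [x [y [[UW' _] ftE]]]].
  have [y' yE] := lift_UV uv y UW' VV kp.
  have [|u [_ uE]] := pb_lift pb (s := y' ∘ x) (t := t).
    by rewrite compmA yE.
  by have [u' u'E] := vcorefl_lift uv u rc BT; exists u'; rewrite -compmA u'E.
- move=> T t BT; rewrite -compmA => /(null_lift uv km VV BT).
  exact: (vcorefl_null uv rc BT).
Qed.

(** [S ->> D] is the cokernel of the inflation [f'] with components [w] and [-
f], so [D] is in [U] since [f] is epic; the kernel [K] of [W' ->> S ->> D] is in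
[V] since [f] is monic. Hence [W' ->> D] splits, and so does [f']. *)
Lemma heart_balanced X Y (f : Hom X Y) : in_H U V X -> in_H U V Y ->
  (forall T (t : Hom T X), in_H U V T -> null (f ∘ t) -> null t) ->
  (forall Z (s : Hom Y Z), in_H U V Z -> null (s ∘ f) -> null s) ->
  exists g : Hom Y X, null (g ∘ f - idm X) /\ null (f ∘ g - idm Y).
Proof.
move=> HX HY mono epi.
have [_ [WX [UX [w [p [WWX UU wp]]]]]] := HX.
have [[VY [WY [k [g [VV WWY kg]]]]] _] := HY.
have [D [i [b [p' [po ip' _]]]]] := po_conf f wp.
have UD := epi_U uv HY WWX UU wp po epi.
have [S [i1 [i2 [p1 [p2 [bS cS]]]]]] := po_biprod po wp.
set f' := i1 ∘ w - i2 ∘ f in cS; set q := b ∘ p1 + i ∘ p2 in cS.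
have [p1i1 p2i2 p2i1 p1i2 sum1] := bS.
have p2f' : p2 ∘ f' = - f.
  by rewrite compmBr !compmA p2i1 p2i2 comp0m comp1m sub0r.
have [W' [g1 [c [k' [pbW kg1 _]]]]] := pb_conf p2 kg.
have [i1' [ic _]] := pb_defl (is_pullbackC pbW) (biprod_conf bS).
have WW' : subW U V W'.
  case: WWX WWY => [UWX VWX] [UWY VWY].
  by split; [exact: (U_ext uv ic) | exact: (V_ext uv ic)].
have [K [ka kq]] := deflation_comp (conf_defl kg1) (conf_defl cS).
have [|m mE] := conf_lift cS (t := g1 ∘ ka).
  by rewrite compmA (conf0 kq).
have pbK : is_pullback g f m (- (c ∘ ka)).
  split; first by rewrite compmN compmA
    (pb_sq pbW) -compmA -mE compmA p2f' compNm opprK.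
  move=> T s t st.
  have [|x [cx gx]] := pb_lift pbW (s := - s) (t := f' ∘ t).
    by rewrite compmA p2f' compNm compmN st.
  have [|u uE] := conf_lift kq (t := x).
    by rewrite -compmA gx compmA (conf0 cS) comp0m.
  exists u; split.
    split; first by rewrite compNm -compmA uE cx opprK.
    by apply: (conf_mono cS); rewrite compmA mE -compmA uE gx.
  move=> u' [cu mu]; apply: (conf_mono kq); rewrite uE; apply: (pb_uniq pbW).
    by rewrite cx -cu compNm opprK compmA.
  by rewrite gx -mu !compmA mE.
have VK := mono_V HX WWY VV kg pbK mono.
have [si siE] := lift_UV uv (idm D) UD VK kq.
have [|r [rf _ _ _ sumr]] := conf_split cS (s := g1 ∘ si);
  first by rewrite compmA.
have fE : f = - (p2 ∘ f') by rewrite p2f' opprK.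
exists (- (r ∘ i2)); split.
  rewrite compNm fE compmN opprK.
  have -> : r ∘ i2 ∘ (p2 ∘ f') = r ∘ (i2 ∘ p2) ∘ f' by rewrite !compmA.
  have -> : i2 ∘ p2 = idm S - i1 ∘ p1 by rewrite -sum1 addrC addKr.
  rewrite compmBr compmBl compm1 rf addrC addKr.
  apply: nullN; rewrite compmA -compmA; exact: null_W.
rewrite compmN fE compNm opprK.
have -> : p2 ∘ f' ∘ (r ∘ i2) = p2 ∘ (f' ∘ r) ∘ i2 by rewrite !compmA.
have -> : f' ∘ r = idm S - g1 ∘ si ∘ q by rewrite -sumr addrK.
rewrite compmBr compmBl compm1 p2i2 addrC addKr.
have -> : p2 ∘ (g1 ∘ si ∘ q) ∘ i2 = p2 ∘ g1 ∘ (si ∘ q ∘ i2).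
  by rewrite !compmA.
by apply: nullN; exact: null_W.
Qed.

End Heart.

(** * Exactness in preadditive categories *)

Section Preadditive.
Variable C : preaddCat.
Implicit Types X Y Z T : C.

Definition monic X Y (f : Hom X Y) :=
    forall T (t : Hom T X), f ∘ t = 0 -> t = 0.
Definition epic X Y (f : Hom X Y) := forall T (t : Hom Y T), t ∘ f = 0 -> t = 0.

Lemma kernel_monic X Y Z K (c : Hom X Y) (d : Hom Y Z) (m : Hom K X) :
  monic d -> is_kernel c m -> is_kernel (d ∘ c) m.
Proof.
move=> md [cm km]; split; first by rewrite -compmA cm compm0.
by move=> T t; rewrite -compmA => /md; exact: km.
Qed.

Lemma exact_monic X Y Z (f : Hom X Y) (g : Hom Y Z) :
  exact_at f g -> is_zero X -> monic g.
Proof.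
move=> [I [m [[Q [c [[cf cok] [cm _]]]] [_ ker]]]] X0 T t gt0.
have [|u [uc _]] := cok _ (idm Y); first by rewrite (proj1 (X0 _) f) compm0.
have m0 : m = 0 by rewrite -[m]comp1m -uc -compmA cm compm0.
by have [w [<- _]] := ker _ t gt0; rewrite m0 comp0m.
Qed.

Lemma exact_epic X Y Z (f : Hom X Y) (g : Hom Y Z) :
  exact_at f g -> is_zero Z -> epic f.
Proof.
move=> [I [m [[Q [c [[cf cok] [cm _]]]] [_ ker]]]] Z0 T t tf0.
have [|w [mw _]] := ker _ (idm Y); first by rewrite (proj2 (Z0 _) g) comp0m.
have [v [<- _]] := cok _ t tf0.
by rewrite -[c]compm1 -mw (compmA c) cm comp0m compm0.
Qed.

Lemma exact_zero X Y Z (f : Hom X Y) (g : Hom Y Z) :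
  exact_at f g -> is_zero X -> is_zero Z -> is_zero Y.
Proof.
move=> fg X0 Z0; apply/idm0_zero/(exact_monic fg X0).
by rewrite (proj2 (Z0 _) g) comp0m.
Qed.

Lemma zero_retract X Y (i : Hom X Y) (p : Hom Y X) :
  p ∘ i = idm X -> is_zero Y -> is_zero X.
Proof.
by move=> pi Y0; apply: idm0_zero; rewrite -pi (proj2 (Y0 _) i) compm0.
Qed.

End Preadditive.

(** The objects are required to agree definitionally, which avoids transport. *)
Lemma functor_eq (C D : preaddCat) (ob : C -> D)
    (m m' : forall X Y : C, Hom X Y -> Hom (ob X) (ob Y)) i c i' c' :
  (forall X Y f, m X Y f = m' X Y f) ->
  @Functor C D ob m i c = @Functor C D ob m' i' c'.
Proof.
move=> mm; have mE : m = m'.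
  apply: functional_extensionality_dep => X.
  by apply: functional_extensionality_dep => Y; exact/funext/mm.
by subst m'; congr Functor; exact: Prop_irrelevance.
Qed.

Lemma eq_nat_iso (C D : preaddCat) (F G : functor C D) : F = G -> nat_iso F G.
Proof.
move=> <-; exists (fun X => idm (F X)); split=> [X Y f|X].
  by rewrite comp1m compm1.
by exists (idm (F X)); rewrite comp1m.
Qed.

(** * Half exact functors vanishing on both halves of the cotorsion pair *)

Section Killing.
Variables (B : exactCat) (U V : addSub B) (D : preaddCat) (G : functor B D).
Hypothesis Gex : half_exact G.

Lemma fmap_retract X Y (i : Hom X Y) (p : Hom Y X) :
  p ∘ i = idm X -> fmap G p ∘ fmap G i = idm (G X).
Proof. by move=> pi; rewrite -fmapM pi fmap1. Qed.

Hypothesis GU : forall X, U X -> is_zero (G X).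
Hypothesis GV : forall X, V X -> is_zero (G X).

(** Epic by the cokernel [U0]; monic by the conflation [U1 >-> W1 + X ->> Y] of
the defining pushout, in which [X] is a direct summand. *)
Lemma fmap_urefl X Y (a : Hom X Y) : urefl U V a ->
  monic (fmap G a) /\ epic (fmap G a).
Proof.
move=> ra; split; last first.
  have [U0 [q [UU aq]]] := urefl_conf ra.
  exact: (exact_epic (Gex aq) (GU UU)).
move: ra => [U1 [W1 [U0 [j [r [u [w [UU1 _ _ jr po]]]]]]]].
have [S [i1 [i2 [p1 [p2 [[_ pi2 _ pi12 _] cS]]]]]] := po_biprod po jr.
have mS := exact_monic (Gex cS) (GU UU1).
have aE : (w ∘ p1 + a ∘ p2) ∘ i2 = a.
  by rewrite compmDl -!compmA pi12 pi2 compm0 compm1 add0r.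
move=> T t; rewrite -aE fmapM -compmA => /mS /(congr1 (compm (fmap G p2))).
by rewrite compmA (fmap_retract pi2) comp1m compm0.
Qed.

Lemma fmap_vcorefl X Y (b : Hom X Y) : vcorefl U V b ->
  monic (fmap G b) /\ epic (fmap G b).
Proof.
move=> rb; split.
  have [V0 [k [VV kb]]] := vcorefl_conf rb.
  exact: (exact_monic (Gex kb) (GV VV)).
move: rb => [V1 [W1 [V0 [j [r [u [w [VV1 _ _ jr pb]]]]]]]].
have [S [i1 [i2 [p1 [p2 [[_ pi2 pi21 _ _] cS]]]]]] := pb_biprod pb jr.
have eS := exact_epic (Gex cS) (GV VV1).
have bE : p2 ∘ (i1 ∘ w + i2 ∘ b) = b.
  by rewrite compmDr !compmA pi21 pi2 comp0m comp1m add0r.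
move=> T t; rewrite -bE fmapM compmA => /eS /(congr1 (fun x => x ∘ fmap G i2)).
by rewrite -compmA (fmap_retract pi2) compm1 comp0m.
Qed.

End Killing.

(** * The half exact functor *)

Section HeartCat.
Variables (B : exactCat) (U V : addSub B).
Hypothesis uv : cotorsion_pair U V.
Local Notation null := (null U V).
Local Notation cls := (@qclass B (subW U V) _ _).
Local Notation heart_square := (heart_square U V).
Local Notation heart := (heart U V).

Lemma cls_eq (X Y : B) (f g : Hom X Y) : cls f = cls g <-> null (f - g).
Proof. exact: qclassP. Qed.

Lemma cls0 (X Y : B) : cls (0 : Hom X Y) = 0.
Proof. by apply: (addrI (cls 0)); rewrite -qclassD !addr0. Qed.

Lemma cls_eq0 (X Y : B) (f : Hom X Y) : cls f = 0 <-> null f.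
Proof. by rewrite -cls0 cls_eq subr0. Qed.

Lemma heart_comp (X Y Z : heart) (g : @Hom B (sval Y) (sval Z))
    (f : @Hom B (sval X) (sval Y)) :
  (cls g : Hom Y Z) ∘ (cls f : Hom X Y) = cls (g ∘ f).
Proof. by rewrite qclassM. Qed.

Lemma heart_zero (X : heart) : is_zero X <-> @factors_through B (subW U V) _ _
    (@idm B (sval X)).
Proof.
split=> [X0|]; first by apply/cls_eq0; exact: (proj1 (X0 X) (idm X)).
by move/cls_eq0 => X0; exact: (@idm0_zero heart X X0).
Qed.

Lemma heart_has_kernel (X Y : heart) (f : Hom X Y) :
  exists K (m : Hom K X), is_kernel f m.
Proof.
have [K [m [HK fm lift uniq]]] :=
  heart_kernel uv (repr f) (svalP X) (proj1 (svalP Y)).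
exists (exist _ K HK), (cls m); rewrite -(qclass_repr f); split.
  by rewrite heart_comp; exact/cls_eq0.
move=> T t; rewrite -(qclass_repr t) heart_comp => /cls_eq0 ft.
have [t' t'E] := lift _ _ (proj2 (svalP T)) ft.
exists (cls t'); split; first by rewrite heart_comp t'E.
move=> s; rewrite -(qclass_repr s) heart_comp => /cls_eq st.
apply/cls_eq/uniq; first exact: (proj2 (svalP T)).
by rewrite compmBr t'E; exact: nullBC.
Qed.

Lemma heart_iso (X Y : heart) (f : Hom X Y) : monic f -> epic f -> is_iso f.
Proof.
move=> mf ef;
  have [||g [gf fg]] := heart_balanced uv (f := repr f) (svalP X) (svalP Y).
- move=> T t HT /cls_eq0 ft; apply/cls_eq0.
  by apply: (mf (exist _ T HT)); rewrite -[f]qclass_repr heart_comp.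
- move=> T t HT /cls_eq0 ft; apply/cls_eq0.
  by apply: (ef (exist _ T HT)); rewrite -[f]qclass_repr heart_comp.
exists (cls g); rewrite -[f]qclass_repr.
by rewrite !heart_comp; split; apply/cls_eq; [exact gf | exact fg].
Qed.

Definition hobj (X : B) (d : heart_square X) : heart :=
    exist _ (hob d) (hobP d).

Definition hmor (X Y : B) (dX : heart_square X) (dY : heart_square Y)
    (f : Hom X Y) :
  Hom (hobj dX) (hobj dY) := cls (sval (cid (lifts_to_exists uv dX dY f))).

Lemma hmorE (X Y : B) (dX : heart_square X) (dY : heart_square Y)
    (f : Hom X Y) h :
  lifts_to dX dY f h -> hmor dX dY f = cls h.
Proof.
move=> fh; apply/cls_eq; apply: (lifts_to_uniq uv) fh.
exact: (svalP (cid (lifts_to_exists uv dX dY f))).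
Qed.

Lemma hmor_spec (X Y : B) (dX : heart_square X) (dY : heart_square Y)
    (f : Hom X Y) :
  exists2 h, lifts_to dX dY f h & hmor dX dY f = cls h.
Proof.
have [h fh] := lifts_to_exists uv dX dY f.
by exists h => //; exact: hmorE.
Qed.

(** The square of identities is chosen on the heart, so that [H] restricts there
to the quotient functor on the nose. *)
Definition square_of (X : B) : heart_square X :=
  match pselect (in_H U V X) with
  | left HX => heart_square_H HX
  | right _ => sval (cid (heart_square_exists uv X))
  end.

Lemma hmor1 (X : B) : hmor (square_of X) (square_of X) (idm X) = idm
    (hobj (square_of X)).
Proof. by rewrite (hmorE (lifts_to_id _)). Qed.

Lemma hmorM (X Y Z : B) (g : Hom Y Z) (f : Hom X Y) :
  hmor (square_of X) (square_of Z) (g ∘ f) =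
    hmor (square_of Y) (square_of Z) g ∘ hmor (square_of X) (square_of Y) f.
Proof.
have [h fh ->] := hmor_spec (square_of X) (square_of Y) f.
have [k gk ->] := hmor_spec (square_of Y) (square_of Z) g.
by rewrite (hmorE (lifts_to_comp fh gk)) heart_comp.
Qed.

Definition hfunctor : functor B heart := Functor hmor1 hmorM.

Lemma hfunctor_restr : frestr (in_H U V) hfunctor = pi_H U V.
Proof.
pose dH (X : fullSub (in_H U V)) : heart_square (sval X) :=
  heart_square_H (svalP X).
have datE : (fun X : fullSub (in_H U V) => square_of (sval X)) = dH.
  apply: functional_extensionality_dep => -[X HX].
  rewrite /square_of /dH /=; case: pselect => // HX'.
  by congr (heart_square_H _); exact: Prop_irrelevance.
(* Both the objects and the morphisms of the restriction depend on the chosen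
   squares, which are therefore replaced all at once. *)
suff gen (d : forall X : fullSub (in_H U V), heart_square (sval X)) : d = dH ->
    forall i c, @Functor (fullSub (in_H U V)) heart (fun X => hobj (d X))
      (fun X Y f => hmor (d X) (d Y) f) i c = pi_H U V.
  exact: gen datE _ _.
move=> -> i c; apply: functor_eq => X Y f.
have ff : @lifts_to B U V (sval X) (sval Y) (dH X) (dH Y) f f.
  by exists f; rewrite /= !comp1m !compm1.
exact: (hmorE ff).
Qed.

Lemma hfunctor_half_exact : half_exact hfunctor.
Proof.
move=> X Y Z f g fg /=.
have fgH : hmor (square_of Y) (square_of Z) g ∘ hmor (square_of X)
  (square_of Y) f = 0.
  rewrite -hmorM (conf0 fg) (hmorE (h := 0)) ?cls0 //.
  by exists 0; rewrite !comp0m !compm0.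
have [h fh hE] := hmor_spec (square_of X) (square_of Y) f.
have [k gk kE] := hmor_spec (square_of Y) (square_of Z) g.
have [Q [c [HQ ch desc uniq mono]]] := hob_exact uv fg fh gk.
rewrite hE kE in fgH *.
pose q : Hom (hobj (square_of Y)) (exist _ Q HQ : heart) := cls c.
have cokq : is_cokernel
  (cls h : Hom (hobj (square_of X)) (hobj (square_of Y))) q.
  split; first by rewrite heart_comp; exact/cls_eq0.
  move=> T t; rewrite -(qclass_repr t) heart_comp => /cls_eq0 th.
  have [t' t'E] := desc _ _ (proj1 (svalP T)) th.
  exists (cls t'); split; first by rewrite heart_comp t'E.
  move=> s; rewrite -(qclass_repr s) heart_comp => /cls_eq st.
  apply/cls_eq/uniq; first exact: (proj1 (svalP T)).
  by rewrite compmBl t'E; exact: nullBC.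
have [c' [c'E _]] := cokq.2 _ _ fgH.
have [K [m km]] := heart_has_kernel q.
exists K, m; split; first by exists (exist _ Q HQ), q.
rewrite -c'E; apply: kernel_monic => // T t.
rewrite -(qclass_repr t) -(qclass_repr c') heart_comp => /cls_eq0 c't.
apply/cls_eq0; apply: (mono (repr c')) c't; last exact: (proj2 (svalP T)).
by apply/cls_eq; rewrite -c'E -(heart_comp (X := hobj (square_of Y))
  (Y := exist _ Q HQ) (Z := hobj (square_of Z))) qclass_repr.
Qed.

Lemma hfunctor_zero (X : B) : is_zero (hfunctor X) <-> in_addUV U V X.
Proof.
split=> [/heart_zero|]; first exact: hob_null_addUV.
move=> [Y [S [i1 [i2 [p1 [p2 [[pi _ _ _ _] [UX [VX [i [p [UU VV ip]]]]]]]]]]]].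
apply: (zero_retract (fmap_retract hfunctor pi)).
apply: (exact_zero (hfunctor_half_exact ip)); apply/heart_zero.
  exact: hob_null_U.
exact: hob_null_V.
Qed.

(** [G] inverts the two legs of [X <- X- -> H X] since they become monic and
epic, and [G (H X)] is [H X]. *)
Lemma hfunctor_unique (G : functor B heart) :
  half_exact G -> frestr (in_H U V) G = pi_H U V ->
  (forall X : B, in_addUV U V X -> is_zero (G X)) -> nat_iso G hfunctor.
Proof.
move=> Gex /eq_nat_iso [th [thN thI]] GK.
have GU X : U X -> is_zero (G X) by move=> UX; apply: GK; exact: addUV_U.
have GV X : V X -> is_zero (G X) by move=> VX; apply: GK; exact: addUV_V.
pose Hob X : fullSub (in_H U V) :=
  exist _ (hob (square_of X)) (hobP (square_of X)).
have [tau [tauN tauI]] : exists tau : forall X, Hom (G (hob (square_of X)))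
  (hfunctor X),
    (forall X Y (h : Hom (hob (square_of X)) (hob (square_of Y))), 
      tau Y ∘ fmap G h =
      (cls h : Hom (hfunctor X) (hfunctor Y)) ∘ tau X) /\
    (forall X, is_iso (tau X)).
  exists (fun X => th (Hob X)); split=> [X Y h|X]; last exact (thI (Hob X)).
  exact (thN (Hob X) (Hob Y) h).
have betaI X : is_iso (fmap G (hbeta (square_of X))).
  have [m e] := fmap_vcorefl Gex GV (hbeta_corefl (square_of X)).
  exact: heart_iso.
have aI X : is_iso (fmap G (ha (square_of X))).
  have [m e] := fmap_urefl Gex GU (ha_refl (square_of X)).
  exact: heart_iso.
have etaP X : exists e : Hom (G X) (hfunctor X),
    is_iso e /\ e ∘ fmap G (hbeta (square_of X)) = tau X ∘ fmap G
      (ha (square_of X)).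
  have [b [b1 b2]] := betaI X; have [a [a1 a2]] := aI X.
  have [t [t1 t2]] := tauI X.
  exists (tau X ∘ fmap G (ha (square_of X)) ∘ b); split; last first.
    by rewrite (reassoc b1) compm1.
  exists (fmap G (hbeta (square_of X)) ∘ a ∘ t); split.
    rewrite !compmA (reassoc t1) compm1 (reassoc a1) compm1; exact: b2.
  rewrite !compmA (reassoc b1) compm1 (reassoc a2) compm1; exact: t2.
pose eta X := sval (cid (etaP X)).
have etaE X : eta X ∘ fmap G (hbeta (square_of X)) =
    tau X ∘ fmap G (ha (square_of X)) := (svalP (cid (etaP X))).2.
exists eta; split=> [X Y f|X]; last exact: (svalP (cid (etaP X))).1.
have [h [f' [bf hf]] hE] := hmor_spec (square_of X) (square_of Y) f.
have [b [_ b2]] := betaI X.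
rewrite -[LHS]compm1 -[RHS]compm1 -b2 !compmA; congr (_ ∘ b).
rewrite -[LHS]compmA -fmapM -bf fmapM compmA etaE -compmA -fmapM -hf fmapM.
rewrite -[RHS]compmA etaE !compmA; congr (_ ∘ _).
by rewrite [fmap hfunctor f]hE; exact: tauN.
Qed.

End HeartCat.

Theorem theorem1p3 (B : exactCat) (U V : addSub B)
    (B_KS : krull_schmidt B)
    (B_proj : enough_projectives B) (B_inj : enough_injectives B)
    (UV_cotorsion : cotorsion_pair U V) :
  exists H : functor B (heart U V),
    (half_exact H /\
     frestr (in_H U V) H = pi_H U V /\
     (forall X : B, is_zero (H X) <-> in_addUV U V X)) /\
    (forall G : functor B (heart U V),
       half_exact G ->
       frestr (in_H U V) G = pi_H U V ->
       (forall X : B, in_addUV U V X -> is_zero (G X)) ->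
       nat_iso G H).
Proof.
exists (hfunctor UV_cotorsion); split; last exact: hfunctor_unique.
split; first exact: hfunctor_half_exact.
by split; [exact: hfunctor_restr | exact: hfunctor_zero].
Qed.
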